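(* Let $m$ be a non-zero cube-free integer and let $C$ be the elliptic curve $U^3+V^3=mW^3$ with identity $(-1,1,0)$. If $\operatorname{rank}(C/\mathbb{Q})=1$, then the equation $u^3+v^3=m$ has at most $2$ solutions $(u,v)\in\mathbb{Z}^2$, and any such solution, regarded as the point $(u,v,1)$ of $C(\mathbb{Q})$, generates the group $C(\mathbb{Q})$.
   Context: $C(\mathbb{Q})$ is the set of projective rational points of $U^3+V^3=mW^3$, made into a group by the usual chord and tangent addition; the identity is $(-1,1,0)$ and the inverse of $(U,V,W)$ is $(V,U,W)$. $\operatorname{rank}(C/\mathbb{Q})$ is the rank of the finitely generated abelian group $C(\mathbb{Q})$. *)

(* Defs.v *)
From HB Require Import structures.
From mathcomp Require Import all_boot all_order all_algebra.
From mathcomp Require Import ring lra.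

Set Implicit Arguments.
Unset Strict Implicit.
Unset Printing Implicit Defensive.

Import Order.TTheory GRing.Theory Num.Theory.
Local Open Scope ring_scope.

Definition cube_free (m : int) : Prop :=
  forall d : nat, (1 < d)%N -> ~~ (d ^ 3 %| `|m|)%N.

(* A point of P^2(Q) is represented by its unique homogeneous coordinate
   vector (U, V, W) whose last nonzero coordinate is 1. *)
Definition triple : Type := (rat * rat * rat)%type.

Definition normalized (p : triple) : bool :=
  let: (u, v, w) := p in
  if w != 0 then w == 1 else if v != 0 then v == 1 else u == 1.

Definition scale (c : rat) (p : triple) : triple :=
  let: (u, v, w) := p in (c * u, c * v, c * w).

Definition proj (p : triple) : triple :=
  let: (u, v, w) := p in
  scale (if w != 0 then w else if v != 0 then v else u)^-1 p.

Definition cubic (m : rat) (p : triple) : rat :=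
  let: (u, v, w) := p in u ^+ 3 + v ^+ 3 - m * w ^+ 3.

(* One third of the derivative of the cubic at p in the direction q. *)
Definition polar (m : rat) (p q : triple) : rat :=
  let: (u1, v1, w1) := p in let: (u2, v2, w2) := q in
  u1 ^+ 2 * u2 + v1 ^+ 2 * v2 - m * w1 ^+ 2 * w2.

(* lin s p t q = s p + t q parametrizes the line through p and q. *)
Definition lin (s : rat) (p : triple) (t : rat) (q : triple) : triple :=
  let: (u1, v1, w1) := p in let: (u2, v2, w2) := q in
  (s * u1 + t * u2, s * v1 + t * v2, s * w1 + t * w2).

(* Third intersection with the cubic of the line through two distinct points
   p and q: by cubic_lin below, the restriction of the cubic to this line is
   3 s t (s * polar p q + t * polar q p). *)
Definition chord (m : rat) (p q : triple) : triple :=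
  lin (polar m q p) p (- polar m p q) q.

(* Residual intersection with the cubic of its tangent line at p: see
   tangentP below. *)
Definition tangent (m : rat) (p : triple) : triple :=
  let: (u, v, w) := p in
  (u * (v ^+ 3 + m * w ^+ 3), - (v * (u ^+ 3 + m * w ^+ 3)),
   w * (u ^+ 3 - v ^+ 3)).

Definition third (m : rat) (p q : triple) : triple :=
  proj (if p == q then tangent m p else chord m p q).

Definition base : triple := (-1, 1, 0).

Definition chord_tangent_add (m : rat) (p q : triple) : triple :=
  third m base (third m p q).

Definition swap (p : triple) : triple := let: (u, v, w) := p in (v, u, w).

Definition chord_tangent_opp (p : triple) : triple := proj (swap p).

Lemma cubic_lin m p q s t :
  cubic m (lin s p t q) =
    s ^+ 3 * cubic m p + t ^+ 3 * cubic m q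
    + 3%:R * s * t * (s * polar m p q + t * polar m q p).
Proof. by case: p => -[u1 v1] w1; case: q => -[u2 v2] w2 /=; ring. Qed.

Lemma tangentP m p : cubic m p = 0 ->
  polar m p (tangent m p) = 0 /\ cubic m (tangent m p) = 0.
Proof.
case: p => -[u v] w /= h.
have e : u ^+ 3 = m * w ^+ 3 - v ^+ 3 by rewrite -[RHS]addr0 -h; ring.
by split; ring: e.
Qed.

Section GroupLaw.

Variable m : rat.
Hypothesis m0 : m != 0.

Implicit Types (p q r : triple) (c d : rat).

Let zero : triple := (0, 0, 0).
Let crv p := normalized p && (cubic m p == 0).

Lemma scale_scale c d p : scale c (scale d p) = scale (c * d) p.
Proof. by case: p => -[u v] w /=; rewrite !mulrA. Qed.

Lemma scale1 p : scale 1 p = p.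
Proof. by case: p => -[u v] w /=; rewrite !mul1r. Qed.

Lemma scale_eq0 c p : c != 0 -> (scale c p == zero) = (p == zero).
Proof.
by case: p => -[u v] w c0; rewrite /zero /= !xpair_eqE !mulf_eq0 (negPf c0).
Qed.

Lemma proj_scale p : p != zero -> exists2 c, c != 0 & proj p = scale c p.
Proof.
case: p => -[u v] w; rewrite /zero !xpair_eqE /proj => h.
eexists; last by [].
rewrite invr_eq0; case: ifP => // /negbFE w0; case: ifP => // /negbFE v0.
by move: h; rewrite w0 v0 !andbT.
Qed.

Lemma projZ c p : c != 0 -> proj (scale c p) = proj p.
Proof.
case: p => -[u v] w c0; rewrite /proj /= !mulf_eq0 (negPf c0) /=.
case: ifP => [w0|_]; first by congr (_, _, _); field; rewrite c0 w0.
case: ifP => [v0|_]; first by congr (_, _, _); field; rewrite c0 v0.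
have [->|u0] := eqVneq u 0; first by rewrite !mulr0 invr0 !mul0r.
by congr (_, _, _); field; rewrite c0 u0.
Qed.

Lemma normalized_proj p : p != zero -> normalized (proj p).
Proof.
case: p => -[u v] w; rewrite /zero !xpair_eqE /proj /= => h.
case: (eqVneq w 0) h => /= [->|w0 _]; last by rewrite mulVf.
rewrite mulr0 eqxx /= andbT.
case: (eqVneq v 0) => /= [->|v0 _]; last by rewrite mulVf // oner_eq0 eqxx.
by rewrite mulr0 eqxx andbT /= => u0; rewrite mulVf.
Qed.

Lemma proj_id p : normalized p -> proj p = p.
Proof.
case: p => -[u v] w; rewrite /normalized /proj.
by case: ifP => [_ /eqP->|_]; [|case: ifP => [_ /eqP->|_ /eqP->]];
  rewrite invr1 scale1.
Qed.

Lemma normalized_neq0 p : normalized p -> p != zero.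
Proof.
by case: p => -[u v] w; rewrite /zero; apply: contraTneq => -[-> -> ->].
Qed.

Definition proportional p q : Prop :=
  let: (u1, v1, w1) := p in let: (u2, v2, w2) := q in
  [/\ u1 * v2 = u2 * v1, u1 * w2 = u2 * w1 & v1 * w2 = v2 * w1].

Lemma proportional_scale p q : p != zero -> q != zero -> proportional p q ->
  exists2 c, c != 0 & p = scale c q.
Proof.
case: p => -[u1 v1] w1; case: q => -[u2 v2] w2 p0 q0 [e1 e2 e3].
suff [c pE] : exists c, (u1, v1, w1) = scale c (u2, v2, w2).
  by exists c => //; apply: contraNneq p0 => c0; rewrite pE c0 /= !mul0r.
have [w20|w20] := eqVneq w2 0; last first.
  exists (w1 / w2); congr (_, _, _); apply: (mulIf w20); rewrite ?e2 ?e3;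
    by field.
have [v20|v20] := eqVneq v2 0; last first.
  have w10 : w1 = 0.
    by apply/eqP; have /eqP := e3; rewrite w20 mulr0 eq_sym mulf_eq0 (negPf v20).
  exists (v1 / v2); rewrite /scale w20 w10 mulr0.
  by congr (_, _, _); apply: (mulIf v20); rewrite ?e1; field.
have u20 : u2 != 0.
  by apply: contraNneq q0 => u20; rewrite u20 v20 w20.
exists (u1 / u2); rewrite /scale w20 v20 !mulr0 mulfVK //.
move: e1 e2; rewrite v20 w20 !mulr0 => /esym/eqP + /esym/eqP.
by rewrite !mulf_eq0 (negPf u20) /= => /eqP-> /eqP->.
Qed.

Lemma proj_eq p q : p != zero -> q != zero -> proportional p q ->
  proj p = proj q.
Proof. by move=> p0 q0 /(proportional_scale p0 q0)[c c0 ->]; rewrite projZ. Qed.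

Lemma cubicZ c p : cubic m (scale c p) = c ^+ 3 * cubic m p.
Proof. by case: p => -[u v] w /=; ring. Qed.

Lemma crv_proj p : p != zero -> cubic m p = 0 -> crv (proj p).
Proof.
move=> p0 hp; rewrite /crv normalized_proj //=.
by have [c _ ->] := proj_scale p0; rewrite cubicZ hp mulr0.
Qed.

Lemma cube_eqN (x y : rat) : x ^+ 3 + y ^+ 3 = 0 -> x = - y.
Proof.
move=> h; have : (x + y) * ((x - y) ^+ 2 + x ^+ 2 + y ^+ 2) = 0.
  by transitivity (2%:R * (x ^+ 3 + y ^+ 3)); [ring | rewrite h mulr0].
move=> /eqP; rewrite mulf_eq0 => /orP[/eqP xy|]; first by lra.
rewrite paddr_eq0 ?addr_ge0 ?sqr_ge0 // paddr_eq0 ?sqr_ge0 //.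
by rewrite !sqrf_eq0 => /andP[/andP[_ /eqP->] /eqP->]; rewrite oppr0.
Qed.

Variant crv_spec p : Prop :=
| CrvBase of p = base
| CrvAffine u v of p = (u, v, 1) & u ^+ 3 + v ^+ 3 = m.

Lemma crvP p : crv p -> crv_spec p.
Proof.
case: p => -[u v] w /andP[]; rewrite /normalized /cubic.
have [-> /=|_ /= /eqP-> /eqP h] := eqVneq w 0; last first.
  by apply: (CrvAffine (u := u) (v := v)) => //; lra.
have [-> /= /eqP->|_ /= /eqP-> /eqP h] := eqVneq v 0.
  by rewrite !expr0n expr1n mulr0 addr0 subr0 oner_eq0.
left; rewrite /base (_ : u = -1) //.
by apply: cube_eqN; rewrite -h; ring.
Qed.

Lemma crv_base : crv base.
Proof. by rewrite /crv /=; apply/eqP; ring. Qed.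

Lemma swapK p : swap (swap p) = p.
Proof. by case: p => -[]. Qed.

Lemma swapZ c p : swap (scale c p) = scale c (swap p).
Proof. by case: p => -[]. Qed.

Lemma swap_eq0 p : (swap p == zero) = (p == zero).
Proof. by case: p => -[u v] w; rewrite /zero !xpair_eqE (andbC (v == 0)). Qed.

Lemma cubic_swap p : cubic m (swap p) = cubic m p.
Proof. by case: p => -[u v] w /=; ring. Qed.

Lemma proj_swap_proj p : p != zero -> proj (swap (proj p)) = proj (swap p).
Proof. by move=> /proj_scale[c c0 ->]; rewrite swapZ projZ. Qed.

Lemma crv_opp p : crv p -> crv (chord_tangent_opp p).
Proof.
case/andP => /normalized_neq0 p0 /eqP hp.
by apply: crv_proj; rewrite ?swap_eq0 ?cubic_swap.
Qed.

(* The unnormalized third intersection of the line through p and q. *)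
Let raw p q := if p == q then tangent m p else chord m p q.

Lemma cubic_raw p q : crv p -> crv q -> cubic m (raw p q) = 0.
Proof.
rewrite /raw => /andP[_ /eqP hp] /andP[_ /eqP hq]; case: ifP => _.
  by have [_ ->] := tangentP hp.
by rewrite /chord cubic_lin hp hq; ring.
Qed.

Lemma neq0_affine (u v : rat) : u ^+ 3 + v ^+ 3 = m -> u + v != 0.
Proof.
move=> h; apply: contraNneq m0 => uv.
by rewrite -h (_ : u = - v) ?sqrrN; [apply/eqP; ring | lra].
Qed.

Lemma chord_base p : crv p -> p != base -> exists2 c, c != 0 &
  chord m base p = scale c (swap p).
Proof.
move=> /crvP[->|u v -> h _]; rewrite ?eqxx //.
have uv := neq0_affine h; exists (- (u + v)); first by rewrite oppr_eq0.
by rewrite /= ; congr (_, _, _); ring.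
Qed.

Lemma tangent_base : tangent m base = base.
Proof. by rewrite /base /=; congr (_, _, _); ring. Qed.

Lemma swap_base : swap base = scale (-1) base.
Proof. by apply/eqP. Qed.

Lemma third_base p : crv p -> third m base p = proj (swap p).
Proof.
move=> cp; rewrite /third; have [<-|pb] := eqVneq base p.
  by rewrite tangent_base swap_base projZ.
by have [|c c0 ->] := chord_base cp; rewrite 1?eq_sym // projZ.
Qed.

Lemma chordC p q : chord m q p = scale (-1) (chord m p q).
Proof.
case: p => -[u1 v1] w1; case: q => -[u2 v2] w2 /=.
by congr (_, _, _); ring.
Qed.

Lemma thirdC p q : third m p q = third m q p.
Proof.
rewrite /third eq_sym; case: eqP => [->//|_].
by rewrite chordC projZ // oppr_eq0 oner_eq0.
Qed.

Lemma chord_neq0 p q : crv p -> crv q -> p != q -> chord m p q != zero.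
Proof.
move=> cp cq pq; have [pb|pb] := eqVneq p base.
  rewrite pb; have [|c c0 ->] := chord_base cq; first by rewrite -pb eq_sym.
  rewrite scale_eq0 // swap_eq0; apply: normalized_neq0; by case/andP: cq.
have [qb|qb] := eqVneq q base.
  have [c c0 e] := chord_base cp pb.
  rewrite qb chordC e scale_scale scale_eq0 ?mulf_neq0 ?oppr_eq0 ?oner_eq0 //.
  by rewrite swap_eq0; apply: normalized_neq0; case/andP: cp.
move: pq; case/crvP: cp pb => [->|u1 v1 -> h1 _]; first by rewrite eqxx.
case/crvP: cq qb => [->|u2 v2 -> h2 _ pq]; first by rewrite eqxx.
apply: contraNneq pq; rewrite /chord.
set B := polar m _ _; set A := polar m _ _.
rewrite /zero /lin => -[e1 e2 e3].
have eAB : A = B by lra.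
have [B0|B0] := eqVneq B 0; last first.
  have eu : u1 = u2 by apply: (mulfI B0); rewrite eAB in e1; lra.
  have ev : v1 = v2 by apply: (mulfI B0); rewrite eAB in e2; lra.
  by rewrite eu ev.
have hB : u2 ^+ 2 * u1 + v2 ^+ 2 * v1 - m = 0 by rewrite -B0 /B /=; ring.
have hA : u1 ^+ 2 * u2 + v1 ^+ 2 * v2 - m = 0.
  by rewrite -B0 -eAB /A /=; ring.
have d : u1 - u2 = - (v1 - v2).
  apply: cube_eqN; rewrite -[RHS](subrr (m - m)) -{1}h1 -{1}h2.
  transitivity (u1 ^+ 3 + v1 ^+ 3 - (u2 ^+ 3 + v2 ^+ 3)
    - 3%:R * (u1 ^+ 2 * u2 + v1 ^+ 2 * v2 - m)
    + 3%:R * (u2 ^+ 2 * u1 + v2 ^+ 2 * v1 - m)); first by ring.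
  by rewrite hA hB; ring.
have u1E : u1 = u2 + v2 - v1 by lra.
have [dv|dv] := eqVneq v1 v2.
  by rewrite u1E dv addrK.
have s1 : (v1 - v2) * (u1 ^+ 2 - v1 ^+ 2) = 0.
  transitivity (u1 ^+ 2 * u2 + v1 ^+ 2 * v2 - m - (u1 ^+ 3 + v1 ^+ 3 - m)).
    by rewrite u1E; ring.
  by rewrite hA h1; ring.
have s2 : (v1 - v2) * (v2 ^+ 2 - u2 ^+ 2) = 0.
  transitivity (u2 ^+ 2 * u1 + v2 ^+ 2 * v1 - m - (u2 ^+ 3 + v2 ^+ 3 - m)).
    by rewrite u1E; ring.
  by rewrite hB h2; ring.
have dv' : v1 - v2 != 0 by rewrite subr_eq0.
have uv1 : u1 = v1.
  move/eqP: s1; rewrite mulf_eq0 (negPf dv') /= subr_sqr mulf_eq0.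
  by rewrite (negPf (neq0_affine h1)) orbF subr_eq0 => /eqP.
have uv2 : v2 = u2.
  move/eqP: s2; rewrite mulf_eq0 (negPf dv') /= subr_sqr mulf_eq0.
  by rewrite (addrC v2 u2) (negPf (neq0_affine h2)) orbF subr_eq0 => /eqP.
by case/eqP: dv; lra.
Qed.

Lemma tangent_neq0 p : crv p -> tangent m p != zero.
Proof.
case/crvP => [->|u v -> h].
  by rewrite /zero !xpair_eqE /= !expr0n !mulr0 !addr0 !expr1n mulr1 oppr_eq0.
apply/eqP => -[e1 e2 e3].
have uv : u ^+ 3 = v ^+ 3 by lra.
have vm : v ^+ 3 + m = 3%:R / 2%:R * m by lra.
have um : u ^+ 3 + m = 3%:R / 2%:R * m by lra.
have : u * m = 0 by move: e1; rewrite expr1n mulr1 vm => e1; lra.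
have : v * m = 0 by move: e2; rewrite expr1n mulr1 um => e2; lra.
move=> /eqP; rewrite mulf_eq0 (negPf m0) orbF => /eqP v0.
move=> /eqP; rewrite mulf_eq0 (negPf m0) orbF => /eqP u0.
by case/eqP: m0; rewrite -h u0 v0; ring.
Qed.

Lemma raw_neq0 p q : crv p -> crv q -> raw p q != zero.
Proof.
rewrite /raw => cp cq; case: ifP => [_|/negbT pq]; first exact: tangent_neq0.
exact: chord_neq0.
Qed.

Lemma crv_third p q : crv p -> crv q -> crv (third m p q).
Proof. by move=> cp cq; apply: crv_proj; [apply: raw_neq0|apply: cubic_raw]. Qed.

Lemma crv_add p q : crv p -> crv q -> crv (chord_tangent_add m p q).
Proof. by move=> cp cq; apply: crv_third (crv_third cp cq); apply: crv_base. Qed.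

Lemma addE p q : crv p -> crv q ->
  chord_tangent_add m p q = proj (swap (raw p q)).
Proof.
move=> cp cq; rewrite /chord_tangent_add third_base ?crv_third //.
by rewrite /third -/(raw p q) proj_swap_proj ?raw_neq0.
Qed.

Lemma chord_tangent_addC p q : chord_tangent_add m p q = chord_tangent_add m q p.
Proof. by rewrite /chord_tangent_add [third m p q]thirdC. Qed.

Lemma chord_tangent_add0 p : crv p -> chord_tangent_add m base p = p.
Proof.
move=> cp; have [np _] := andP cp.
rewrite /chord_tangent_add (third_base cp) third_base; last exact: crv_opp.
by rewrite proj_swap_proj ?swap_eq0 ?normalized_neq0 // swapK proj_id.
Qed.

Lemma chord_tangent_addN p : crv p ->
  chord_tangent_add m (chord_tangent_opp p) p = base.
Proof.
move=> cp; rewrite addE ?crv_opp // -[RHS](proj_id (p := base)) //.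
case/crvP: cp => [->|u v -> h].
  rewrite /chord_tangent_opp swap_base projZ // (proj_id (p := base)) //.
  by rewrite /raw eqxx tangent_base swap_base projZ.
have -> : chord_tangent_opp (u, v, 1) = (v, u, 1) by apply: proj_id.
rewrite /raw !xpair_eqE eqxx andbT (eq_sym u v) andbb.
have uv := neq0_affine h; have [vu|vu] := eqVneq v u.
  rewrite vu in h uv *.
  transitivity (proj (scale (u * (u ^+ 3 + m)) base)).
    by congr proj; rewrite /=; congr (_, _, _); ring.
  rewrite projZ // mulf_eq0 negb_or.
  have u0 : u != 0 by apply: contraNneq uv => ->; rewrite addr0.
  rewrite u0 -h /= (_ : _ + _ = 3%:R * u ^+ 3); last by ring.
  by rewrite mulf_neq0 // expf_neq0.
transitivity (proj (scale ((u + v) * (u - v) ^+ 3) base)).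
  by congr proj; rewrite -h /=; congr (_, _, _); ring.
by rewrite projZ // mulf_neq0 // expf_neq0 // subr_eq0 eq_sym.
Qed.

(* Two bihomogeneous forms of the addition law, exchanged by swap; each gives
   the sum of p and q up to a scalar, and they never vanish together. *)
Definition law1 p q : triple :=
  let: (u1, v1, w1) := p in let: (u2, v2, w2) := q in
  (u2 ^+ 2 * u1 * v1 + m * w1 ^+ 2 * w2 * v2,
   - (m * w2 ^+ 2 * w1 * u1) - v1 ^+ 2 * u2 * v2,
   v2 ^+ 2 * w1 * v1 - u1 ^+ 2 * w2 * u2).

Definition law2 p q : triple :=
  let: (u1, v1, w1) := p in let: (u2, v2, w2) := q in
  (- (m * w2 ^+ 2 * w1 * v1) - u1 ^+ 2 * v2 * u2,
   v2 ^+ 2 * v1 * u1 + m * w1 ^+ 2 * w2 * u2,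
   u2 ^+ 2 * w1 * u1 - v1 ^+ 2 * w2 * v2).

Definition law (b : bool) := if b then law1 else law2.

Lemma lawZl b c p q : law b (scale c p) q = scale (c ^+ 2) (law b p q).
Proof.
by case: p => -[u1 v1] w1; case: q => -[u2 v2] w2; case: b => /=;
  congr (_, _, _); ring.
Qed.

Lemma lawZr b c p q : law b p (scale c q) = scale (c ^+ 2) (law b p q).
Proof.
by case: p => -[u1 v1] w1; case: q => -[u2 v2] w2; case: b => /=;
  congr (_, _, _); ring.
Qed.

Lemma law_add b p q : crv p -> crv q -> law b p q != zero ->
  chord_tangent_add m p q = proj (law b p q).
Proof.
move=> cp cq l0; rewrite addE //.
apply: proj_eq => //; first by rewrite swap_eq0 raw_neq0.
case/crvP: cp {l0} => [->|u1 v1 -> h1]; case/crvP: cq => [->|u2 v2 -> h2].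
- by case: b; rewrite /raw eqxx /=; split; ring.
- rewrite /raw !xpair_eqE (eq_sym 0) oner_eq0 andbF.
  have e2 : u2 ^+ 3 = m - v2 ^+ 3 by lra.
  by case: b; rewrite /=; split; ring: e2.
- rewrite /raw !xpair_eqE oner_eq0 andbF.
  have e1 : u1 ^+ 3 = m - v1 ^+ 3 by lra.
  by case: b; rewrite /=; split; ring: e1.
have e1 : u1 ^+ 3 = m - v1 ^+ 3 by lra.
have e2 : u2 ^+ 3 = m - v2 ^+ 3 by lra.
rewrite /raw; case: eqP => [[-> ->]|_].
  by case: b; rewrite /=; split; ring: e2.
by case: b; rewrite /=; split; ring: e1 e2.
Qed.

Lemma triple_eq (u1 v1 w1 u2 v2 w2 : rat) :
  (u1, v1, w1) = (u2, v2, w2) -> [/\ u1 = u2, v1 = v2 & w1 = w2].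
Proof. by case=> -> -> ->. Qed.

Lemma law_neq0 p q : crv p -> crv q -> exists b, law b p q != zero.
Proof.
move=> cp cq; have [l1|] := eqVneq (law true p q) zero; last by exists true.
have [l2|] := eqVneq (law false p q) zero; last by exists false.
suff mE : m = 0 by case/eqP: m0.
move: l1 l2; rewrite /law /zero.
case/crvP: cp => [->|u1 v1 -> h1]; case/crvP: cq => [->|u2 v2 -> h2] /=.
- by move=> /triple_eq[e _ _]; lra.
- move=> /triple_eq[e1 e2 _] /triple_eq[e3 e4 _]; rewrite -h2.
  have [-> | u0] := eqVneq u2 0; last by nra.
  by have [-> | v0] := eqVneq v2 0; [ring|nra].
- move=> /triple_eq[e1 e2 _] /triple_eq[e3 e4 _]; rewrite -h1.
  have [-> | u0] := eqVneq u1 0; last by nra.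
  by have [-> | v0] := eqVneq v1 0; [ring|nra].
move=> /triple_eq[e1 e2 e3] /triple_eq[e4 e5 e6].
have f1 : v2 * (v1 ^+ 3 + m) = 0.
  transitivity ((u2 ^+ 2 * u1 * v1 + m * 1 ^+ 2 * 1 * v2)
    - v1 * (u2 ^+ 2 * 1 * u1 - v1 ^+ 2 * 1 * v2)); first by ring.
  by rewrite e1 e6; ring.
have f2 : u2 * (u1 ^+ 3 + m) = 0.
  transitivity ((v2 ^+ 2 * v1 * u1 + m * 1 ^+ 2 * 1 * u2)
    - u1 * (v2 ^+ 2 * 1 * v1 - u1 ^+ 2 * 1 * u2)); first by ring.
  by rewrite e5 e3; ring.
have [v20|v20] := eqVneq v2 0.
  have u20 : u2 = 0.
    apply: (mulfI m0); rewrite mulr0 -e5 v20; ring.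
  by rewrite -h2 u20 v20; ring.
have [u20|u20] := eqVneq u2 0.
  case/eqP: v20; apply: (mulfI m0); rewrite mulr0 -e1 u20; ring.
move/eqP: f1; rewrite mulf_eq0 (negPf v20) /= => /eqP f1.
move/eqP: f2; rewrite mulf_eq0 (negPf u20) /= => /eqP f2.
by lra.
Qed.

Lemma law_assoc b1 b2 b3 b4 u1 v1 u2 v2 u3 v3 :
  u1 ^+ 3 + v1 ^+ 3 = m -> u2 ^+ 3 + v2 ^+ 3 = m -> u3 ^+ 3 + v3 ^+ 3 = m ->
  let p := (u1, v1, 1) in let q := (u2, v2, 1) in let r := (u3, v3, 1) in
  proportional (law b1 p (law b2 q r)) (law b3 (law b4 p q) r).
Proof.
move=> h1 h2 h3 p q r.
have e1 : u1 ^+ 3 = m - v1 ^+ 3 by lra.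
have e2 : u2 ^+ 3 = m - v2 ^+ 3 by lra.
have e3 : u3 ^+ 3 = m - v3 ^+ 3 by lra.
by case: b1; case: b2; case: b3; case: b4; rewrite /=; split; ring: e1 e2 e3.
Qed.

Lemma chord_tangent_addA p q r : crv p -> crv q -> crv r ->
  chord_tangent_add m p (chord_tangent_add m q r) =
  chord_tangent_add m (chord_tangent_add m p q) r.
Proof.
move=> cp cq cr.
case/crvP: (cp) => [->|u1 v1 pE h1].
  by rewrite !chord_tangent_add0 //; apply: crv_add.
case/crvP: (cq) => [->|u2 v2 qE h2].
  by rewrite (chord_tangent_addC p base) !chord_tangent_add0.
case/crvP: (cr) => [->|u3 v3 rE h3].
  by rewrite !(chord_tangent_addC _ base) !chord_tangent_add0 //; apply: crv_add.
have [b1 qr0] := law_neq0 cq cr; have [b2 pq0] := law_neq0 cp cq.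
have cqr := crv_add cq cr; have cpq := crv_add cp cq.
have [c c0 qrE] := proj_scale qr0; have [d d0 pqE] := proj_scale pq0.
have [b3 l0] := law_neq0 cp cqr; have [b4 r0] := law_neq0 cpq cr.
rewrite (law_add cp cqr l0) (law_add cpq cr r0).
move: l0 r0; rewrite (law_add cq cr qr0) (law_add cp cq pq0) qrE pqE.
rewrite lawZl lawZr !scale_eq0 ?expf_neq0 // => l0 r0.
rewrite !projZ ?expf_neq0 //; apply: proj_eq => //.
by rewrite pE qE rE; apply: law_assoc.
Qed.

End GroupLaw.

(* C(Q) for C : U^3 + V^3 = m W^3; the hypothesis m != 0 makes the cubic
   smooth and the chord and tangent law a group law. *)
Record CQ (m : int) (hm : m != 0) : Type := MkCQ {
  coords :> triple;
  coordsP : normalized coords && (cubic m%:~R coords == 0) }.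

Section CQGroup.

Variables (m : int) (hm : m != 0).

HB.instance Definition _ := [isSub for @coords m hm].
HB.instance Definition _ := [Choice of CQ hm by <:].

Let hmQ : (m%:~R : rat) != 0.
Proof. by rewrite intr_eq0. Qed.

Definition CQ_zero : CQ hm := MkCQ hm (crv_base _).

Definition CQ_opp (p : CQ hm) : CQ hm := MkCQ hm (crv_opp (coordsP p)).

Definition CQ_add (p q : CQ hm) : CQ hm :=
  MkCQ hm (crv_add hmQ (coordsP p) (coordsP q)).

Fact CQ_addA : associative CQ_add.
Proof.
by move=> p q r; apply: val_inj; apply: chord_tangent_addA => //; apply: coordsP.
Qed.

Fact CQ_addC : commutative CQ_add.
Proof. by move=> p q; apply: val_inj; apply: chord_tangent_addC. Qed.

Fact CQ_add0 : left_id CQ_zero CQ_add.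
Proof.
by move=> p; apply: val_inj; apply: chord_tangent_add0 => //; apply: coordsP.
Qed.

Fact CQ_addN : left_inverse CQ_zero CQ_opp CQ_add.
Proof.
by move=> p; apply: val_inj; apply: chord_tangent_addN => //; apply: coordsP.
Qed.

HB.instance Definition _ :=
  GRing.isZmodule.Build (CQ hm) CQ_addA CQ_addC CQ_add0 CQ_addN.

End CQGroup.

Fact integral_pointP (m u v : int) : u ^+ 3 + v ^+ 3 = m ->
  let p : triple := (u%:~R, v%:~R, 1) in
  normalized p && (cubic m%:~R p == 0).
Proof.
by move=> <-; rewrite /= expr1n mulr1 rmorphD !rmorphXn subrr.
Qed.

Definition integral_point (m : int) (hm : m != 0) (u v : int)
    (h : u ^+ 3 + v ^+ 3 = m) : CQ hm :=
  MkCQ hm (integral_pointP h).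

Section AbelianGroups.

Variable A : zmodType.

Definition independent (n : nat) (x : 'I_n -> A) : Prop :=
  forall k : 'I_n -> int, \sum_(i < n) x i *~ k i = 0 -> forall i, k i = 0.

(* The rank of an abelian group: the largest size of a Z-independent family. *)
Definition has_rank (r : nat) : Prop :=
  (exists x : 'I_r -> A, independent x) /\
  (forall (n : nat) (x : 'I_n -> A), independent x -> (n <= r)%N).

Definition generates (x : A) : Prop := forall y : A, exists n : int, y = x *~ n.

End AbelianGroups.

(* Main.v *)
(* For |m| <= 2 a descent in Z[sqrt -3] shows that every rational point is
   torsion, so the rank is not 1.  Let |m| > 2.  A nonzero rational point has
   pairwise coprime coordinates (U, V, W), because m is cube-free; this gives
   W(R) | W(nR), and W(2R) > W(R), so that the group is torsion-free and an even
   multiple is never integral.  If P = nR is integral with n = 2k + 1 > 1, then R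
   is integral too, and P = S + T, R = T - S for S = kR, T = (k + 1)R.  With
   x = UV / W^2, integrality of x(P) and x(R) forces x(S) - x(T) to have
   numerator dividing 3; S and T are then so close to each other that, one of
   them being non-integral, the sum and the product of x(P) and x(R) cannot both
   respect the bound |x| <= |m| valid at integral points.  Hence an integral
   point is a multiple nR only for n = 1, -1, and in rank 1 this makes it a
   generator. *)

Require Import Defs.
From mathcomp Require Import all_boot all_order all_algebra.
From mathcomp Require Import cyclic.
From mathcomp Require Import ring lra zify.
From Stdlib Require Import Classical_Prop.

Set Implicit Arguments.
Unset Strict Implicit.
Unset Printing Implicit Defensive.

Import Order.TTheory GRing.Theory Num.Theory.
Local Open Scope ring_scope.

(** * Descent in Z[sqrt(-3)] *)

Lemma cube_coprimen (a b c : nat) :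
  coprime a b -> (a * b = c ^ 3)%N -> exists d, (a = d ^ 3)%N.
Proof.
have [->|c0] := posnP c.
  move=> cab /eqP; rewrite exp0n // muln_eq0 => /orP[/eqP->|/eqP b0].
    by exists 0%N.
  by exists 1%N; apply/eqP; move: cab; rewrite b0 /coprime gcdn0.
(* At each prime one of [a], [b] has valuation 0, so that of [a] is 0 or three times that of [c];
   either way the gcd has a third of it. *)
move=> cab abc; exists (gcdn a c).
have ab0 : (0 < a * b)%N by rewrite abc expn_gt0 c0.
have /andP[a0 b0] : (0 < a)%N && (0 < b)%N by rewrite -muln_gt0.
apply: eqn_from_log => // [|p]; first by rewrite expn_gt0 gcdn_gt0 a0.
rewrite lognX logn_gcd //.
have : (logn p a + logn p b = 3 * logn p c)%N by rewrite -lognM // abc lognX.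
have : logn p a = 0%N \/ logn p b = 0%N.
  have [pp|np] := boolP (prime p); last by left; rewrite /logn (negPf np).
  have [pa|pa] := boolP (p %| a)%N.
    right; apply: contraTeq cab; rewrite -lt0n logn_gt0 => pb.
    rewrite /coprime; apply: contraTneq pp => gE.
    have : (p %| gcdn a b)%N.
      by rewrite dvdn_gcd pa; move: pb; rewrite mem_primes => /and3P[].
    by rewrite gE dvdn1 => /eqP->.
  by left; apply/eqP; rewrite -leqn0 leqNgt logn_gt0 mem_primes (negPf pa)
    !andbF.
lia.
Qed.

Lemma cube_coprimez (a b c : int) :
  coprimez a b -> a * b = c ^+ 3 -> exists d : int, a = d ^+ 3.
Proof.
move=> cab abc.
have [|d dE] := @cube_coprimen `|a| `|b| `|c| cab.
  by rewrite -abszM abc abszX.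
have [a0|a0] := lerP 0 a.
  by exists d; rewrite -(gez0_abs a0) dE; lia.
by exists (- d%:Z); rewrite -[LHS]opprK -(ltz0_abs a0) dE; lia.
Qed.

Lemma coprimez_addM (a b k : int) : coprimez a b -> coprimez a (b + k * a).
Proof.
move=> /coprimezP[[u v] /= e]; apply/coprimezP; exists (u - v * k, v) => /=.
by rewrite -e; ring.
Qed.

Lemma cube_coprime3 (a b c z : int) :
  coprimez a b -> coprimez a c -> coprimez b c -> a * b * c = z ^+ 3 ->
  exists a1 b1 c1 : int, [/\ a = a1 ^+ 3, b = b1 ^+ 3 & c = c1 ^+ 3].
Proof.
move=> ab ac bc h.
have [a1 a1E] : exists d, a = d ^+ 3.
  by apply: (@cube_coprimez a (b * c) z); rewrite ?coprimezMr ?ab // mulrA.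
have [b1 b1E] : exists d, b = d ^+ 3.
  apply: (@cube_coprimez b (a * c) z); last by rewrite mulrCA mulrA.
  by rewrite coprimezMr coprimez_sym ab.
have [c1 c1E] : exists d, c = d ^+ 3.
  apply: (@cube_coprimez c (a * b) z); last by rewrite mulrC.
  by rewrite coprimezMr coprimez_sym ac coprimez_sym.
by exists a1, b1, c1.
Qed.

Lemma coprimez2 (a : int) : coprimez 2 a = ~~ (2 %| a)%Z.
Proof. by rewrite coprimezE prime_coprime. Qed.

Lemma coprimez3 (a : int) : coprimez 3 a = ~~ (3 %| a)%Z.
Proof. by rewrite coprimezE prime_coprime. Qed.

(* A pair (r, s) stands for r + s sqrt(-3), of norm r^2 + 3 s^2. *)
Lemma norm3_root_split (c d t : int) :
  0 < c -> 0 < d -> ~~ (2 %| c)%Z -> ~~ (2 %| d)%Z -> t ^+ 2 + 3 = c * d ->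
  exists r s r' s' : int, [/\ c = r ^+ 2 + 3 * s ^+ 2,
    d = r' ^+ 2 + 3 * s' ^+ 2, t = r * r' - 3 * s * s' & 1 = r * s' + s * r'].
Proof.
move: {-1}(`|c|)%N (leqnn `|c|) => n; elim: n c d t => [|n IH] c d t; first lia.
move=> cn c0 d0 c2 d2 h.
have [c1|c1] := eqVneq c 1.
  by exists 1, 0, t, 1; split; rewrite ?c1; lia.
have t2 : (2 %| t)%Z by nia.
(* [t0] is the residue of [t] modulo [2 * c] of least absolute value. Then [t0 ^+ 2 + 3 = d1 * c]
   with [d1 < c], and the induction applies to [d1]. *)
have [k [t0 [tE t02 lb ub]]] : exists k t0 : int,
    [/\ t = t0 + c * k, (2 %| t0)%Z, - c < t0 & t0 < c].
  have cn0 : 2 * c != 0 by lia.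
  have e := divz_eq t (2 * c).
  have m0 := modz_ge0 t cn0.
  have m1 : (t %% (2 * c))%Z < 2 * c by apply: ltz_pmod; lia.
  set m := (t %% (2 * c))%Z in e m0 m1; set j := (t %/ (2 * c))%Z in e.
  have m2 : (2 %| m)%Z.
    by have -> : m = t + 2 * (- c * j); [rewrite e; ring | lia].
  have [mc|mc] := ltrP m c.
    by exists (2 * j), m; split=> //; [rewrite e; ring | lia].
  exists (2 * j + 2), (m - 2 * c); split; [rewrite e; ring | lia | | lia].
  have : m != c by apply: contraNneq c2 => <-.
  by lia.
pose d1 := d - k * (t + t0).
have h1 : t0 ^+ 2 + 3 = d1 * c.
  transitivity (c * d - c * k * (t + t0)); last by rewrite /d1; ring.
  by rewrite -h tE; ring.
have c3 : 3 <= c by lia.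
have d10 : 0 < d1 by nia.
have d1c : d1 < c.
  rewrite -(ltr_pM2r c0) -h1; clear -lb ub c3; nia.
have d12 : ~~ (2 %| d1)%Z by apply: contraNN c2 => ?; nia.
have [|//|//|//|//|r [s [r' [s' [e1 e2 e3 e4]]]]] := IH d1 c t0 _ _ _ _ _ h1.
  by lia.
(* [t + sqrt -3] is [t0 + sqrt -3] plus [k * c], and [c] is the norm of [r' + s' sqrt -3]; taking
   out this factor leaves [r + s sqrt -3] plus [k] times its conjugate. *)
exists r', s', (r + k * r'), (s - k * s'); split=> //.
- apply: (@mulfI _ c); first by lia.
  rewrite -h tE e3 e2.
  transitivity (((r * r' - 3 * s * s') + (r' ^+ 2 + 3 * s' ^+ 2) * k) ^+ 2
     + 3 * (r * s' + s * r') ^+ 2); first by rewrite -e4; ring.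
  by ring.
- by rewrite tE e3 e2; ring.
- by rewrite e4; ring.
Qed.

(** Reduction to [b = 1]: since [b] is invertible modulo [c], [a] is [b * t] modulo [c] with [t]
    even, and [c] divides [t ^+ 2 + 3]. *)
Lemma norm3_split (a b c d : int) :
  coprimez a b -> 0 < c -> 0 < d -> ~~ (2 %| c)%Z ->
  a ^+ 2 + 3 * b ^+ 2 = c * d ->
  exists r s r' s' : int, [/\ c = r ^+ 2 + 3 * s ^+ 2,
    d = r' ^+ 2 + 3 * s' ^+ 2, a = r * r' - 3 * s * s' & b = r * s' + s * r'].
Proof.
move=> ab c0 d0 c2 h.
have bc : coprimez b c.
  have : coprimez b (c * d).
    rewrite -h [b ^+ 2]expr2 mulrA; apply: coprimez_addM.
    by rewrite coprimezXr // coprimez_sym.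
  by rewrite coprimezMr => /andP[].
have /coprimezP[[x y] /= xy] := bc.
have [t [w [tE t2]]] : exists t w : int, a = b * t + c * w /\ (2 %| t)%Z.
  have [ax2|ax2] := boolP (2 %| a * x)%Z.
    by exists (a * x), (a * y); split=> //; rewrite -[LHS]mulr1 -xy; ring.
  (* Adding the odd number [c] corrects the parity of [t]. *)
  exists (a * x + c), (a * y - b); split; last by lia.
  by rewrite -[LHS]mulr1 -xy; ring.
have /dvdzP[d1 d1E] : (c %| t ^+ 2 + 3)%Z.
  rewrite -(@Gauss_dvdzr c (b ^+ 2)); last by rewrite coprimez_sym coprimezXl.
  apply/dvdzP; exists (d - w * (a + b * t)).
  transitivity (a ^+ 2 + 3 * b ^+ 2 - c * w * (a + b * t)).
    by rewrite tE; ring.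
  by rewrite h; ring.
have d10 : 0 < d1 by nia.
have d12 : ~~ (2 %| d1)%Z.
  apply/negP => /dvdzP[d2 d2E]; move/dvdzP: t2 => [t' t'E].
  have : 2 * (d2 * c - 2 * t' ^+ 2) = 3.
    by rewrite -[RHS](addKr (t ^+ 2)) d1E d2E t'E; ring.
  by lia.
have [|r [s [r1 [s1 [e1 e2 e3 e4]]]]] := @norm3_root_split c d1 t c0 d10 c2 d12.
  by rewrite d1E mulrC.
exists r, s, (b * r1 + w * r), (b * s1 - w * s).
have aE : a = r * (b * r1 + w * r) - 3 * s * (b * s1 - w * s).
  by rewrite {1}tE e3 e1; ring.
have bE : b = r * (b * s1 - w * s) + s * (b * r1 + w * r).
  by rewrite -{1}[b]mulr1 e4; ring.
split=> //; apply: (@mulfI _ c); first by lia.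
by rewrite -h; move: aE bE; set r' := _ + w * r; set s' := _ - w * s => -> ->;
  rewrite e1; ring.
Qed.

Lemma coprimez_norm3_factor (r s r' s' : int) :
  coprimez (r * r' - 3 * s * s') (r * s' + s * r') -> coprimez r' s'.
Proof.
move=> /coprimezP[[u v] /= e]; apply/coprimezP.
by exists (u * r + v * s, - (3 * u * s) + v * r); rewrite /= -[RHS]e; ring.
Qed.

(** The product of one element with the conjugate of the other has norm [c ^+ 2] and second
    coordinate divisible by [c], which must therefore vanish. For [c > 1] the coprimality rules out
    conjugate elements. *)
Lemma norm3_eq (c r s r' s' : int) :
  0 < c -> c = r ^+ 2 + 3 * s ^+ 2 -> c = r' ^+ 2 + 3 * s' ^+ 2 ->
  coprimez (r * r' - 3 * s * s') (r * s' + s * r') ->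
  exists2 e : int, e ^+ 2 = 1 & r = e * r' /\ s = e * s'.
Proof.
move=> c0 h h' XY; set X := r * r' - _ in XY; set Y := r * s' + _ in XY.
have XYc : X ^+ 2 + 3 * Y ^+ 2 = c * c by rewrite {1}h h' /X /Y; ring.
have cY : coprimez c Y.
  have : coprimez Y (c * c).
    rewrite -XYc [Y ^+ 2]expr2 mulrA; apply: coprimez_addM.
    by rewrite coprimezXr // coprimez_sym.
  by rewrite coprimezMr coprimez_sym => /andP[].
have /dvdzP[z zE] : (c %| s * r' - r * s')%Z.
  rewrite -(@Gauss_dvdzl c _ Y) //; apply/dvdzP; exists (s ^+ 2 - s' ^+ 2).
  transitivity (s ^+ 2 * (r' ^+ 2 + 3 * s' ^+ 2)
    - s' ^+ 2 * (r ^+ 2 + 3 * s ^+ 2)); first by rewrite /Y; ring.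
  by rewrite -h -h'; ring.
pose T := r * r' + 3 * s * s'.
have hT : T ^+ 2 + 3 * (z * c) ^+ 2 = c ^+ 2.
  by rewrite -zE [c ^+ 2]expr2 {1}h h' /T; ring.
have z0 : z = 0.
  apply/eqP; apply: contraT => zN.
  have z1 : 1 <= z ^+ 2 by rewrite -gtz0_ge1 exprn_even_gt0.
  have cc0 : 0 < c ^+ 2 by rewrite exprn_gt0.
  have : c ^+ 2 <= z ^+ 2 * c ^+ 2 by rewrite ler_peMl // ltW.
  by have := sqr_ge0 T; move: hT; rewrite exprMn; lra.
have sr : s * r' = r * s' by move: zE; rewrite z0 mul0r => /eqP;
  rewrite subr_eq0 => /eqP.
have T2 : (T - c) * (T + c) = 0.
  by rewrite -subr_sqr -hT z0 mul0r expr0n mulr0 addr0 subrr.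
have rT : T * r' = r * c.
  transitivity (r * r' ^+ 2 + 3 * s' * (s * r')); first by rewrite /T; ring.
  by rewrite sr h'; ring.
have sT : T * s' = s * c.
  transitivity (r' * (r * s') + 3 * s * s' ^+ 2); first by rewrite /T; ring.
  by rewrite -sr h'; ring.
have cN0 : c != 0 by rewrite gt_eqF.
move/eqP: T2; rewrite mulf_eq0 => /orP[] /eqP T2.
  exists 1 => //; rewrite !mul1r.
  by split; apply: (mulIf cN0); [rewrite -rT | rewrite -sT];
    have -> : T = c by [lra]; rewrite mulrC.
exists (-1) => //; rewrite !mulN1r.
by split; apply: (mulIf cN0); [rewrite -rT | rewrite -sT];
    have -> : T = - c by [lra]; rewrite mulrC mulrN mulNr.
Qed.

(** Two applications of [norm3_split] give three factors of norm [c]; by [norm3_eq] they agree up to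
    sign, and a sign is its own cube. The formulas expand [(r + s sqrt -3)^3]. *)
Lemma norm3_cube (a b c : int) :
  coprimez a b -> 0 < c -> ~~ (2 %| c)%Z -> a ^+ 2 + 3 * b ^+ 2 = c ^+ 3 ->
  exists r s : int, a = r * (r - 3 * s) * (r + 3 * s)
                 /\ b = 3 * (s * (r - s) * (r + s)).
Proof.
move=> ab c0 c2 h.
have cc0 : 0 < c * c by apply: mulr_gt0.
have [|r [s [r' [s' [e1 e2 e3 e4]]]]] := norm3_split ab c0 cc0 c2.
  by rewrite h; ring.
have ab' : coprimez r' s' by apply: (@coprimez_norm3_factor r s);
  rewrite -e3 -e4.
have [r1 [s1 [r2 [s2 [f1 f2 f3 f4]]]]] := norm3_split ab' c0 c0 c2 (esym e2).
have [|e ee [rE sE]] := @norm3_eq c r1 s1 r s c0 f1 e1.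
  apply: (@coprimez_norm3_factor r2 s2).
  by move: ab; rewrite e3 e4 f3 f4; congr coprimez; ring.
have [|e' ee' [r'E s'E]] := @norm3_eq c r2 s2 r s c0 f2 e1.
  apply: (@coprimez_norm3_factor r1 s1).
  by move: ab; rewrite e3 e4 f3 f4; congr coprimez; ring.
have E3 : (e * e') ^+ 3 = e * e' by rewrite exprMn !(exprS _ 2) ee ee' !mulr1.
exists (e * e' * r), (e * e' * s); split.
  transitivity ((e * e') ^+ 3 * (r * (r - 3 * s) * (r + 3 * s))); last by ring.
  by rewrite E3 e3 f3 f4 rE sE r'E s'E; ring.
transitivity ((e * e') ^+ 3 * (3 * (s * (r - s) * (r + s)))); last by ring.
by rewrite E3 e4 f3 f4 rE sE r'E s'E; ring.
Qed.

Lemma coprimez_oddM (f r x : int) :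
  f = 1 \/ f = 2 -> ~~ (2 %| x)%Z -> coprimez r x -> coprimez (f * r) x.
Proof.
by move=> [->|->] x2 rx; rewrite ?mul1r // coprimezMl rx coprimez2 x2.
Qed.

Lemma odd_cbrt (a x : int) : x = a ^+ 3 -> ~~ (2 %| x)%Z -> ~~ (2 %| a)%Z.
Proof. by move=> ->; apply: contraNN => a2; rewrite exprS dvdz_mulr. Qed.

Lemma coprimez_cbrt (a b : int) : coprimez (a ^+ 3) (b ^+ 3) = coprimez a b.
Proof. by rewrite coprimez_pexpl // coprimez_pexpr. Qed.

Lemma coprime_addsub (r s : int) :
  coprimez r s -> ~~ (2 %| r + s)%Z -> coprimez (r - s) (r + s).
Proof.
move=> rs rs2; have -> : r + s = 2 * s + 1 * (r - s) by ring.
apply: coprimez_addM; rewrite coprimezMr coprimez_sym coprimez2.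
rewrite (_ : r - s = r + - 1 * s); last by ring.
rewrite [coprimez _ s]coprimez_sym coprimez_addM 1?coprimez_sym // andbT.
by apply: contraNN rs2; lia.
Qed.

(** The factors are pairwise coprime; [f] goes with [r] because the two others are odd. The cubes
    satisfy [a ^+ 3 + b ^+ 3 = 2 * r], the next equation in the descent. *)
Lemma cubes_r_mul_r2_sub_9s2 (f r s k : int) : f = 1 \/ f = 2 ->
  coprimez r s -> ~~ (2 %| r + s)%Z -> ~~ (3 %| r)%Z ->
  f * (r * (r - 3 * s) * (r + 3 * s)) = k ^+ 3 ->
  exists a b c : int, [/\ ~~ (2 %| a)%Z && ~~ (2 %| b)%Z, coprimez a b,
    r - 3 * s = a ^+ 3, r + 3 * s = b ^+ 3 & f * r = c ^+ 3].
Proof.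
move=> f12 rs rs2 r3 h.
have rs3 : coprimez r (3 * s)
  by rewrite coprimezMr rs coprimez_sym coprimez3 r3.
have o1 : ~~ (2 %| r - 3 * s)%Z by apply: contraNN rs2; lia.
have o2 : ~~ (2 %| r + 3 * s)%Z by apply: contraNN rs2; lia.
have c12 := coprime_addsub rs3 o2.
have c01 : coprimez (f * r) (r - 3 * s).
  apply: coprimez_oddM => //; rewrite (_ : _ - _ = - (3 * s) + 1 * r);
    last by ring.
  by apply: coprimez_addM; rewrite coprimezN.
have c02 : coprimez (f * r) (r + 3 * s).
  apply: coprimez_oddM => //; rewrite (_ : _ + _ = 3 * s + 1 * r); last by ring.
  exact: coprimez_addM.
have [|c [a [b [cE aE bE]]]] := @cube_coprime3 _ _ _ k c01 c02 c12.
  by rewrite -h; ring.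
exists a, b, c; split=> //; first by rewrite (odd_cbrt aE o1) (odd_cbrt bE o2).
by rewrite -coprimez_cbrt -aE -bE.
Qed.

(** The analogue for a third of the second coordinate of the cube, with
    [b ^+ 3 - a ^+ 3 = 2 * s]. *)
Lemma cubes_s_mul_r2_sub_s2 (f r s k : int) : f = 1 \/ f = 2 ->
  coprimez r s -> ~~ (2 %| r + s)%Z ->
  f * (s * (r - s) * (r + s)) = k ^+ 3 ->
  exists a b c : int, [/\ ~~ (2 %| a)%Z && ~~ (2 %| b)%Z, coprimez a b,
    r - s = a ^+ 3, r + s = b ^+ 3 & f * s = c ^+ 3].
Proof.
move=> f12 rs rs2 h.
have o1 : ~~ (2 %| r - s)%Z by apply: contraNN rs2; lia.
have c12 := coprime_addsub rs rs2.
have sr : coprimez s r by rewrite coprimez_sym.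
have c01 : coprimez (f * s) (r - s).
  apply: coprimez_oddM => //; rewrite (_ : _ - _ = r + -1 * s); last by ring.
  exact: coprimez_addM.
have c02 : coprimez (f * s) (r + s).
  apply: coprimez_oddM => //; rewrite (_ : _ + _ = r + 1 * s); last by ring.
  exact: coprimez_addM.
have [|c [a [b [cE aE bE]]]] := @cube_coprime3 _ _ _ k c01 c02 c12.
  by rewrite -h; ring.
exists a, b, c; split=> //; first by rewrite (odd_cbrt aE o1) (odd_cbrt bE rs2).
by rewrite -coprimez_cbrt -aE -bE.
Qed.

Lemma odd_norm3 (a b : int) :
  ~~ (2 %| a + b)%Z -> ~~ (2 %| a ^+ 2 + 3 * b ^+ 2)%Z.
Proof.
rewrite -!coprimez2 => ab2.
rewrite (_ : _ + _ = (a + b) ^+ 2 + (b ^+ 2 - a * b) * 2); last by ring.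
by apply: coprimez_addM; rewrite coprimezXr.
Qed.

Lemma coprimez_norm3 (a b : int) :
  coprimez a b -> ~~ (3 %| a)%Z -> coprimez a (a ^+ 2 + 3 * b ^+ 2).
Proof.
move=> ab a3; rewrite addrC [a ^+ 2]expr2; apply: coprimez_addM.
by rewrite coprimezMr coprimezXr // andbT coprimez_sym coprimez3.
Qed.

Lemma norm3_ge3 (a b : int) : b != 0 -> 3 <= a ^+ 2 + 3 * b ^+ 2.
Proof.
move=> b0; have : 1 <= b ^+ 2 by rewrite -gtz0_ge1 exprn_even_gt0.
by have := sqr_ge0 a; lra.
Qed.

Lemma ltz_abs_cube (c z u v w : int) :
  c ^+ 3 = u -> z ^+ 3 = u * v * w -> u != 0 -> v != 0 -> 3 <= w ->
  (`|c| < `|z|)%N.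
Proof.
move=> cE zE; rewrite -!absz_gt0 => u0 v0 w3.
rewrite -(@ltn_exp2r _ _ 3) // -!abszX cE zE !abszM -[X in (X < _)%N]muln1
  -mulnA.
rewrite ltn_pmul2l // (@leq_trans `|w|) ?leq_pmull //; lia.
Qed.

(* Fermat's descent for exponent 3, run at once for x^3 + y^3 = z^3 with z even
   and for x^3 + y^3 = 2 z^3. *)
Lemma sum_odd_cubes (e x y z : int) : e = 1 \/ e = 2 ->
  ~~ (2 %| x)%Z -> ~~ (2 %| y)%Z -> coprimez x y ->
  x ^+ 3 + y ^+ 3 = e * z ^+ 3 -> x = y \/ x = - y.
Proof.
(* With [x = p + q] and [y = p - q] the equation becomes [f * p * (p ^+ 2 + 3 * q ^+ 2) = z ^+ 3]
   for both values of [e]. *)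
move=> e12; have [f f12 ef] : exists2 f : int, f = 1 \/ f = 2 & e * f = 2.
  by case: e12 => ->; [exists 2|exists 1] => //; [right|left].
move: {-1}(`|z|)%N (leqnn `|z|) => n;
  elim: n x y z => [|n IH] x y z zn x2 y2 xy h.
  right; have z0 : z = 0 by lia.
  apply: (@intr_inj rat); rewrite rmorphN; apply: cube_eqN.
  by rewrite -!rmorphXn -rmorphD h z0 expr0n mulr0.
have [p [q [xE yE]]] : exists p q : int, x = p + q /\ y = p - q.
  by exists ((x + y) %/ 2)%Z, ((x - y) %/ 2)%Z; clear -x2 y2; lia.
have [p0|p0] := eqVneq p 0; first by right; rewrite xE yE p0; ring.
have [q0|q0] := eqVneq q 0; first by left; rewrite xE yE q0; ring.
have pq : coprimez p q.
  have /coprimezP[[u v] /= uv] := xy; apply/coprimezP; exists (u + v, u - v).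
  by rewrite /= -uv xE yE; ring.
have pq2 : ~~ (2 %| p + q)%Z by rewrite -xE.
have h' : f * p * (p ^+ 2 + 3 * q ^+ 2) = z ^+ 3.
  apply: (@mulfI _ 2) => //.
  transitivity (f * (x ^+ 3 + y ^+ 3)); first by rewrite xE yE; ring.
  by rewrite h -ef; ring.
have f0 : f != 0 by case: f12 => ->.
have f3 : coprimez 3 f by case: f12 => ->.
(* The induction hypothesis at a smaller solution: [e * f = 2] turns [2 * s] into [e * c ^+ 3]. *)
have closing a b c s : ~~ (2 %| a)%Z -> ~~ (2 %| b)%Z -> coprimez a b ->
    a ^+ 3 + b ^+ 3 = 2 * s -> f * s = c ^+ 3 -> (`|c| < `|z|)%N ->
    a ^+ 3 = b ^+ 3 \/ a ^+ 3 = - b ^+ 3.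
  move=> a2 b2 ab hab hc cz.
  have [||->|->] := IH a b c _ a2 b2 ab; first by rewrite -ltnS (leq_trans cz).
  - by rewrite hab -hc -ef; ring.
  - by left.
  - by right; ring.
(* If 3 does not divide [p], then [f * p] and the norm are coprime, hence both cubes. *)
have [p3|p3] := boolP (3 %| p)%Z; last first.
  have o := odd_norm3 pq2.
  have cop : coprimez (f * p) (p ^+ 2 + 3 * q ^+ 2).
    by apply: coprimez_oddM => //; apply: coprimez_norm3.
  have [c cE] := cube_coprimez cop h'.
  have [d dE] : exists d : int, p ^+ 2 + 3 * q ^+ 2 = d ^+ 3.
    by apply: (@cube_coprimez _ (f * p) z); rewrite 1?coprimez_sym // mulrC.
  have N3 := norm3_ge3 p q0.
  have d0 : 0 < d by rewrite -(@exprn_odd_gt0 _ 3) // -dE; lra.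
  have [r [s [pE qE]]] := norm3_cube pq d0 (odd_cbrt dE o) dE.
  move: cE p0 q0 p3 pq pq2 h'; rewrite pE qE => cE p0 q0 p3 pq pq2 h'.
  move: p0 q0; rewrite !mulf_eq0 !negb_or.
  move=> /andP[/andP[r0 r30] r31] /andP[_ /andP[/andP[s0 _] _]].
  have rs : coprimez r s.
    move: pq; rewrite !coprimezMl => /andP[/andP[+ _] _].
    by rewrite !coprimezMr => /andP[_ /andP[/andP[]]].
  have rs2 : ~~ (2 %| r + s)%Z.
    apply: contraNN pq2 => /dvdzP[k kE];
      have -> : r = k * 2 - s by rewrite -kE; ring.
    apply/dvdzP; exists ((k * 2 - s) * (k * 2 - s - 3 * s) * (k + s)
      + 3 * (s * (k * 2 - s - s) * k)); ring.
  have r3 : ~~ (3 %| r)%Z by apply: contraNN p3 => r3; rewrite -mulrA dvdz_mulr.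
  have [a [b [c1 [/andP[a2 b2] ab aE bE c1E]]]] :=
    cubes_r_mul_r2_sub_9s2 f12 rs rs2 r3 cE.
  have [||||] := closing a b c1 r a2 b2 ab.
  - by rewrite -aE -bE; ring.
  - exact: c1E.
  - apply: (ltz_abs_cube (esym c1E) (v := (r - 3 * s) * (r + 3 * s)) _ _ _ N3).
    + by rewrite -h' pE qE; ring.
    + by rewrite mulf_neq0.
    + by rewrite mulf_neq0.
  - by rewrite -aE -bE; move/eqP: s0; lra.
  - by rewrite -aE -bE; move/eqP: r0; lra.
(* Otherwise 3 divides [z], hence also [p1 = p / 3]. The norm of [q + p1 sqrt -3] takes over, with
   cofactor [f * p2] where [p = 9 * p2]. *)
have /dvdzP[p1 p1E] := p3.
have q3 : coprimez 3 q.
  have : coprimez (p1 * 3) q by rewrite -p1E.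
  by rewrite coprimezMl => /andP[].
have N1 : coprimez 3 (q ^+ 2 + 3 * p1 ^+ 2).
  by rewrite mulrC; apply: coprimez_addM; rewrite coprimezXr.
have /dvdzP[z1 z1E] : (3 %| z)%Z.
  apply: contraT; rewrite -coprimez3 => /(coprimezXr 3).
  rewrite -h' p1E; have -> : f * (p1 * 3) * ((p1 * 3) ^+ 2 + 3 * q ^+ 2)
    = 0 + (3 * f * p1 * (q ^+ 2 + 3 * p1 ^+ 2)) * 3 by ring.
  by rewrite coprimez3 add0r dvdz_mull.
have h1 : f * p1 * (q ^+ 2 + 3 * p1 ^+ 2) = 3 * z1 ^+ 3.
  apply: (@mulfI _ 9) => //; transitivity (z ^+ 3); last by rewrite z1E; ring.
  by rewrite -h' p1E; ring.
have /dvdzP[p2 p2E] : (3 %| p1)%Z.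
  rewrite -(@Gauss_dvdzr 3 f) // -(@Gauss_dvdzl 3 _ (q ^+ 2 + 3 * p1 ^+ 2)) //.
  by rewrite h1 dvdz_mulr.
have h2 : f * p2 * (q ^+ 2 + 3 * p1 ^+ 2) = z1 ^+ 3.
  by apply: (@mulfI _ 3) => //; rewrite -h1 {2}p2E; ring.
have qp1 : coprimez q p1.
  have : coprimez (p1 * 3) q by rewrite -p1E.
  by rewrite coprimezMl coprimez_sym => /andP[].
have qp12 : ~~ (2 %| q + p1)%Z.
  apply: contraNN pq2 => /dvdzP[k kE]; apply/dvdzP; exists (k + p1).
  by rewrite p1E mulrDl -kE; ring.
have o := odd_norm3 qp12.
have cop : coprimez (f * p2) (q ^+ 2 + 3 * p1 ^+ 2).
  apply: coprimez_oddM => //; suff : coprimez p1 (q ^+ 2 + 3 * p1 ^+ 2).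
    by rewrite {1}p2E coprimezMl => /andP[].
  rewrite [p1 ^+ 2]expr2 mulrA; apply: coprimez_addM.
  by rewrite coprimezXr // coprimez_sym.
have p10 : p1 != 0 by apply: contraNneq p0 => p10; rewrite p1E p10 mul0r.
have [c cE] := cube_coprimez cop h2.
have [d dE] : exists d : int, q ^+ 2 + 3 * p1 ^+ 2 = d ^+ 3.
  by apply: (@cube_coprimez _ (f * p2) z1); rewrite 1?coprimez_sym // mulrC.
have N3 := norm3_ge3 q p10.
have d0 : 0 < d by rewrite -(@exprn_odd_gt0 _ 3) // -dE; lra.
have [r [s [qE p1E']]] := norm3_cube qp1 d0 (odd_cbrt dE o) dE.
have p2E' : p2 = s * (r - s) * (r + s).
  by apply: (@mulIf _ 3) => //; rewrite -p2E p1E' mulrC.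
move: q0 p10; rewrite qE p1E' !mulf_eq0 !negb_or.
move=> /andP[/andP[r0 _] _] /andP[_ /andP[/andP[s0 s1] s2]].
have rs : coprimez r s.
  move: qp1; rewrite qE p1E' !coprimezMl => /andP[/andP[+ _] _].
  by rewrite !coprimezMr => /andP[_ /andP[/andP[]]].
have rs2 : ~~ (2 %| r + s)%Z.
  apply: contraNN qp12 => /dvdzP[k kE]; rewrite qE p1E'.
  have -> : r = k * 2 - s by rewrite -kE; ring.
  apply/dvdzP; exists ((k * 2 - s) * (k * 2 - s - 3 * s) * (k + s)
    + 3 * (s * (k * 2 - s - s) * k)); ring.
rewrite p2E' in cE.
have [a [b [c1 [/andP[a2 b2] ab aE bE c1E]]]] :=
  cubes_s_mul_r2_sub_s2 f12 rs rs2 cE.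
have [||||||] := closing b (- a) c1 s b2.
- by rewrite dvdzE abszN.
- by rewrite coprimezN coprimez_sym.
- by rewrite exprNn -bE -aE; ring.
- exact: c1E.
- apply: (@leq_trans `|z1|%N).
    apply: (ltz_abs_cube (esym c1E) (v := (r - s) * (r + s)) _ _ _ N3).
    + by rewrite -h2 p2E'; ring.
    + by rewrite mulf_neq0.
    + by rewrite mulf_neq0.
  by rewrite z1E abszM leq_pmulr.
- by rewrite -bE exprNn -aE; move/eqP: s0; lra.
by rewrite -bE exprNn -aE; move/eqP: r0; lra.
Qed.

(** * The equations x^3 + y^3 = z^3 and x^3 + y^3 = 2 z^3 *)

Lemma sum_odd_cubes_neq_cube (x y z : int) :
  ~~ (2 %| x)%Z -> ~~ (2 %| y)%Z -> coprimez x y ->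
  x ^+ 3 + y ^+ 3 = z ^+ 3 -> z = 0.
Proof.
move=> x2 y2 xy h.
have [||xyE|xyE] := @sum_odd_cubes 1 x y z _ x2 y2 xy;
  [by left|by rewrite mul1r| |].
  (* Here 2 divides [z], so 4 divides [x ^+ 3], although [x] is odd. *)
  have h2 : z ^+ 3 = x ^+ 3 * 2 by rewrite -h -xyE; lra.
  have /dvdzP[w wE] : (2 %| z)%Z.
    apply: contraT; rewrite -coprimez2 => /(coprimezXr 3).
    by rewrite h2 coprimez2 dvdz_mull.
  have x34 : x ^+ 3 = w ^+ 3 * 2 * 2 by move: h2; rewrite wE exprMn; lra.
  move: x2; rewrite -coprimez2 => /(coprimezXr 3).
  by rewrite x34 coprimez2 dvdz_mull.
have /eqP : z ^+ 3 = 0 by rewrite -h xyE exprNn; lra.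
by rewrite expf_eq0 => /eqP.
Qed.

(** One of the three numbers is even; the equation is rearranged so that its cube is a sum of two
    odd cubes. *)
Lemma fermat3 (x y z : int) :
  coprimez x y -> coprimez x z -> coprimez y z -> z != 0 ->
  x ^+ 3 + y ^+ 3 = z ^+ 3 -> x = 0 \/ y = 0.
Proof.
move=> xy xz yz z0 h.
have [x2|x2] := boolP (2 %| x)%Z.
  have z2 : ~~ (2 %| z)%Z by rewrite -coprimez2; apply: coprimez_dvdl xz.
  have y2 : ~~ (2 %| y)%Z by rewrite -coprimez2; apply: coprimez_dvdl xy.
  left; apply: (@sum_odd_cubes_neq_cube z (- y)) => //.
  - by rewrite dvdzE abszN.
  - by rewrite coprimezN coprimez_sym.
  - by rewrite -h exprNn; lra.
have [y2|y2] := boolP (2 %| y)%Z.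
  have z2 : ~~ (2 %| z)%Z by rewrite -coprimez2; apply: coprimez_dvdl yz.
  right; apply: (@sum_odd_cubes_neq_cube z (- x)) => //.
  - by rewrite dvdzE abszN.
  - by rewrite coprimezN coprimez_sym.
  - by rewrite -h exprNn; lra.
by case/eqP: z0; apply: sum_odd_cubes_neq_cube h.
Qed.

Lemma sum_cubes_eq_double_cube (x y z : int) :
  coprimez x y -> z != 0 -> x ^+ 3 + y ^+ 3 = 2 * z ^+ 3 -> x = y.
Proof.
move=> xy z0 h.
have xy2 : ((2 %| x) = (2 %| y))%Z.
  have e a b : a ^+ 3 + b ^+ 3 = 2 * z ^+ 3 -> (2 %| a)%Z -> (2 %| b)%Z.
    move=> h' /dvdzP[k aE]; apply: contraT;
      rewrite -coprimez2 => /(coprimezXr 3).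
    have -> : b ^+ 3 = (z ^+ 3 - k * a ^+ 2) * 2 by move: h';
      rewrite exprS {1}aE; lra.
    by rewrite coprimez2 dvdz_mull.
  by apply/idP/idP; apply: e; rewrite // addrC.
have x2 : ~~ (2 %| x)%Z.
  apply/negP => x2; have := coprimez_dvdl x2 xy.
  by rewrite coprimez2 -xy2 x2.
have y2 : ~~ (2 %| y)%Z by rewrite -xy2.
have [//|xyE] := sum_odd_cubes (or_intror erefl) x2 y2 xy h.
have /eqP : z ^+ 3 = 0 by move: h; rewrite xyE exprNn; lra.
by rewrite expf_eq0 (negPf z0).
Qed.

(** The smallest such difference is [2 ^ 3 - 1 ^ 3 = 7]; exceeding 3 is what makes denominators grow
    under doubling. *)
Lemma diff_cubes_gt3 (u v : int) :
  u != 0 -> v != 0 -> u != v -> u != - v -> (3 < `|u ^+ 3 - v ^+ 3|)%N.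
Proof.
have main a b : b != 0 -> (`|b| < `|a|)%N -> (3 < `|a ^+ 3 - b ^+ 3|)%N.
  move=> b0 ab.
  have /(leq_trans _) : (`|a| ^ 3 - `|b| ^ 3 <= `|a ^+ 3 - b ^+ 3|)%N.
    by rewrite -!abszX; lia.
  apply; have := leq_exp2r (`|b|.+1) `|a| (isT : (0 < 3)%N); rewrite ab.
  move: b0; rewrite -absz_gt0; move: `|b|%N `|a|%N => {a b ab} b a.
  by rewrite !expnS !expn0; nia.
move=> u0 v0 uv uNv; have [ab|ab|ab] := ltngtP `|u|%N `|v|%N.
- by rewrite distnC main.
- exact: main.
- by exfalso; lia.
Qed.

(** * Integral values of UV / W^2 at a sum and a difference *)

Lemma dvdz_coprimez (d a : int) : (d %| a)%Z -> coprimez d a -> (d %| 1)%Z.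
Proof. by move=> da cda; rewrite -(@Gauss_dvdzr d a) // mulr1. Qed.

Lemma coprimez_of_dvd (a b : int) :
  (forall d : int, (d %| a)%Z -> (d %| b)%Z -> (d %| 1)%Z) -> coprimez a b.
Proof.
move=> h; have := h (gcdz a b) (dvdz_gcdl _ _) (dvdz_gcdr _ _).
by rewrite dvdz1 /coprimez -eqz_nat gez0_abs.
Qed.

Lemma coprimez_dvd (d a b : int) : (d %| a)%Z -> coprimez a b -> coprimez d b.
Proof. exact: coprimez_dvdl. Qed.

(* [X1 / O1] and [X2 / O2] are the values of x = UV / W^2 at S and T, and [e]
   and [f] the sum and product of its values at S + T and T - S when these two
   points are integral. *)
Lemma sum_diff_gcd_bound (m X1 O1 X2 O2 e f : int) :
  coprimez X1 O1 -> coprimez X2 O2 -> coprimez m X1 ->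
  let D := (X1 * O2 - X2 * O1) ^+ 2 in
  D != 0 ->
  D * e = 2 * X1 * X2 * (X1 * O2 + X2 * O1) - m ^+ 2 * (O1 * O2) ^+ 2 ->
  D * f = X1 ^+ 2 * X2 ^+ 2 + m ^+ 2 * (O1 * O2) * (X1 * O2 + X2 * O1) ->
  D <= 9.
Proof.
move=> c1 c2 cm D D0 he hf.
pose w := X1 * O2 - X2 * O1; have DE : D = w ^+ 2 by [].
(* By [hf] such a [d] divides [X1 ^+ 2 * X2 ^+ 2], to which it is prime. *)
have cO d : (d %| w)%Z -> (d %| O1)%Z -> (d %| O2)%Z -> (d %| 1)%Z.
  move=> dw d1 d2; have cX1 : coprimez d X1.
    by apply: coprimez_dvd d1 _; rewrite coprimez_sym.
  have cX2 : coprimez d X2 by apply: coprimez_dvd d2 _; rewrite coprimez_sym.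
  apply: (@dvdz_coprimez d (X1 ^+ 2 * X2 ^+ 2)); last first.
    by rewrite coprimezMr !coprimezXr.
  have -> : X1 ^+ 2 * X2 ^+ 2 = w * (w * f)
    - O1 * (m ^+ 2 * O2 * (X1 * O2 + X2 * O1)).
    by rewrite mulrA -expr2 -DE hf; ring.
  by rewrite rpredB // dvdz_mulr.
have cw2 : coprimez w O2.
  apply: coprimez_of_dvd => d dw d2; apply: (cO d) => //.
  rewrite -(@Gauss_dvdzr d X2); last by apply: coprimez_dvd d2 _;
    rewrite coprimez_sym.
  have -> : X2 * O1 = X1 * O2 - w by rewrite /w; ring.
  by rewrite rpredB // dvdz_mull.
(* By [he] a common divisor divides [m ^+ 2 * (O1 * O2) ^+ 2], to which it is prime. *)
have cw1 : coprimez w X1.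
  apply: coprimez_of_dvd => d dw d1.
  have cO1 : coprimez d O1 by apply: coprimez_dvd d1 _.
  have d2 : (d %| X2)%Z.
    rewrite -(@Gauss_dvdzl d _ O1) //.
    have -> : X2 * O1 = X1 * O2 - w by rewrite /w; ring.
    by rewrite rpredB // dvdz_mulr.
  have cO2 : coprimez d O2 by apply: coprimez_dvd d2 _.
  have cdm : coprimez d m by apply: coprimez_dvd d1 _; rewrite coprimez_sym.
  apply: (@dvdz_coprimez d (m ^+ 2 * (O1 * O2) ^+ 2)); last first.
    by rewrite coprimezMr !coprimezXr // coprimezMr cO1.
  have -> : m ^+ 2 * (O1 * O2) ^+ 2 = X1 * (2 * X2 * (X1 * O2 + X2 * O1))
    - w * (w * e) by rewrite (_ : w * (w * e) = D * e); [rewrite he;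
      ring | rewrite mulrA].
  by rewrite rpredB // dvdz_mulr.
pose a := X1 * O2; pose b := X2 * O1.
have cwa : coprimez w a by rewrite /a coprimezMr cw1.
have cwb : coprimez w b.
  have -> : b = a + -1 * w by rewrite /w /a /b; ring.
  exact: coprimez_addM.
(* The combination of [he] and [hf] in which the terms in [m ^+ 2] cancel; the 9 comes from
   [(a + b) ^+ 2 = D + 4 * (a * b)]. *)
have key : 9 * (a * b) ^+ 2
    = D * (f * (O1 * O2) ^+ 2 + e * (O1 * O2) * (a + b) - 2 * (a * b)).
  transitivity (D * f * (O1 * O2) ^+ 2 + D * e * (O1 * O2) * (a + b) - 2 * (a *
    b) * D); last by ring.
  by rewrite he hf DE /w /a /b; ring.
have : (D %| 9)%Z.
  rewrite -(@Gauss_dvdzl D _ ((a * b) ^+ 2)); last first.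
    by rewrite DE coprimezXl // coprimezXr // coprimezMr cwa.
  by rewrite key dvdz_mulr.
by rewrite dvdzE => /dvdn_leq; clear; lia.
Qed.

(** [N] is [O1 * O2]; [q] and [s] are the product and sum of [X1 * O2] and [X2 * O1]. With
    [y = m * N], the first relation gives [3 * y ^+ 2 <= 2 * (q * s)], the second bounds [q ^+ 2] by
    [y ^+ 2 + 2 * y * s]. As [q] is about [s ^+ 2 / 4], the two together bound [s], too tightly for
    the first. *)
Lemma sum_diff_size_contradiction (m N D e f q s : int) :
  7 <= m -> 4 <= N -> 0 <= D -> D <= 9 -> `|e| <= 2 * m -> `|f| <= m ^+ 2 ->
  s ^+ 2 = D + 4 * q ->
  D * e * N = 2 * q * s - m ^+ 2 * N ^+ 3 ->
  9 * q ^+ 2 + 2 * q * D = D * (f * N ^+ 2 + e * N * s) -> False.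
Proof.
move=> m7 N4 D0 D9 /ler_normlP[e1 e2] /ler_normlP[f1 f2] hs h1 h2.
pose y := m * N.
have y28 : 28 <= y by rewrite /y; nia.
have h3 : D * (e * N) <= 18 * y /\ - (18 * y) <= D * (e * N).
  have : e * N <= 2 * y /\ - (2 * y) <= e * N by rewrite /y; split; nia.
  by move=> [a b]; clear -a b D0 D9 y28; split; nia.
have y2N : 4 * y ^+ 2 <= m ^+ 2 * N ^+ 3 by rewrite /y; nia.
have h4 : 3 * y ^+ 2 <= 2 * (q * s) by nia.
have q0 : 0 < q by nia.
have s0 : 0 < s by nia.
have h5 : 9 * q ^+ 2 <= 9 * (y ^+ 2 + 2 * y * s).
  have a : f * N ^+ 2 <= y ^+ 2 by rewrite /y exprMn; nia.
  have eN : e * N <= 2 * y.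
    by rewrite /y mulrA ler_wpM2r // (le_trans _ N4).
  have b : e * N * s <= 2 * y * s by rewrite ler_wpM2r // ltW.
  have c : 0 <= q * D by apply: mulr_ge0; lia.
  have d : 0 <= y ^+ 2 + 2 * y * s by nia.
  have : D * (f * N ^+ 2 + e * N * s) <= 9 * (y ^+ 2 + 2 * y * s).
    apply: (@le_trans _ _ (D * (y ^+ 2 + 2 * y * s))).
      by rewrite ler_wpM2l // lerD.
    by rewrite ler_wpM2r.
  lra.
have h6 : 9 * q ^+ 2 <= 12 * (q * s) + 9 * s ^+ 2.
  have := sqr_ge0 (y - s); rewrite sqrrB; lra.
have yy : 784 <= y ^+ 2 by clear -y28; nia.
(* [q * s] is at least 1176 because [y >= 28], while [s <= 16] would keep it at most 1024. *)
have s17 : 17 <= s.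
  rewrite leNgt; apply/negP => s16.
  have q64 : q <= 64 by clear -hs D0 s16 s0; nia.
  have : q * s <= 64 * 16 by apply: ler_pM; lia.
  by clear -h4 yy; lia.
have q70 : 70 <= q by clear -hs D9 s17; nia.
have h7 : 3 * q <= 4 * s + 13.
  rewrite leNgt; apply/negP => qs.
  have : q * 6 <= q * (9 * q - 12 * s - 36) by rewrite ler_pM2l //; clear -qs;
    lia.
  by clear -h6 hs D9 q70; lia.
by clear -hs D9 s17 h7; nia.
Qed.

(** * Rational points *)

Section Points.

Variables (m : int) (hm : m != 0).

Implicit Types (p q : CQ hm) (U V W X Y Z : int).

Definition of_int U V W : triple := (U%:~R, V%:~R, W%:~R).

Definition primitive_coords p U V W : Prop :=
  [/\ 0 < W, coords p = proj (of_int U V W), U ^+ 3 + V ^+ 3 = m * W ^+ 3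
    & [/\ coprimez U V, coprimez U W & coprimez V W]].

(** At the zero point [(-1, 1, 0)] the value is 1, so integrality is read off from [den] only at
    nonzero points. *)
Definition den p : int := denq (coords p).1.1.

Lemma hmQ : (m%:~R : rat) != 0. Proof. by rewrite intr_eq0. Qed.

Lemma coordsD p q : coords (p + q) = chord_tangent_add m%:~R p q.
Proof. by []. Qed.

Lemma coords_inj p q : coords p = coords q -> p = q.
Proof. exact: val_inj. Qed.

Lemma proj_of_int U V W : W != 0 ->
  proj (of_int U V W) = (U%:~R / W%:~R, V%:~R / W%:~R, 1).
Proof.
move=> W0; rewrite /proj /of_int /= intr_eq0 W0.
by rewrite mulVf ?intr_eq0 // ![W%:~R^-1 * _]mulrC.
Qed.

Lemma den_primitive p U V W : primitive_coords p U V W -> den p = W.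
Proof.
case=> W0 pE _ [_ UW _]; rewrite /den pE proj_of_int ?gt_eqF //=.
by rewrite coprimeq_den // gt_eqF // gtr0_norm.
Qed.

Lemma primitive_neq0 p U V W : primitive_coords p U V W -> p != 0.
Proof.
case=> W0 pE _ _; apply: contraTneq isT => p0.
by move: pE; rewrite p0 proj_of_int ?gt_eqF // => -[].
Qed.

Lemma primitive_opp p U V W :
  primitive_coords p U V W -> primitive_coords (- p) V U W.
Proof.
case=> W0 pE h [UV UW VW]; split=> //; last by rewrite coprimez_sym.
  have -> : coords (- p) = proj (swap (coords p)) by [].
  by rewrite pE proj_swap_proj // xpair_eqE intr_eq0 gt_eqF // andbF.
by rewrite addrC.
Qed.

(* A common factor of U and V is prime to W, so its cube divides m. *)
Lemma primitive_exists p : cube_free m -> p != 0 ->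
  exists U V, primitive_coords p U V (den p).
Proof.
move=> hcf p0; have /crvP := coordsP p; case=> [pE|u v pE h].
  by case/eqP: p0; apply: coords_inj; rewrite pE.
pose U := numq u; pose W := denq u; pose V := numq v; pose D := denq v.
have W0 : 0 < W by apply: denq_gt0.
have D0 : 0 < D by apply: denq_gt0.
have cUW : coprimez U W := coprime_num_den u.
have cVD : coprimez V D := coprime_num_den v.
have uE : u = U%:~R / W%:~R by rewrite divq_num_den.
have vE : v = V%:~R / D%:~R by rewrite divq_num_den.
have hZ : U ^+ 3 * D ^+ 3 + V ^+ 3 * W ^+ 3 = m * W ^+ 3 * D ^+ 3.
  apply: (@intr_inj rat); rewrite !(rmorphD, rmorphM, rmorphXn) /= -h uE vE.
  by field; rewrite !intr_eq0 !gt_eqF.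
(* [W ^+ 3] divides [U ^+ 3 * D ^+ 3], hence [D ^+ 3]; the converse is symmetric. *)
have WD : W = D.
  apply/eqP; rewrite -(gtz0_abs W0) -(gtz0_abs D0) eqz_nat eqn_dvd.
  rewrite -(@dvdn_pexp2r _ _ 3) // -(@dvdn_pexp2r `|D| _ 3) // -!abszX.
  apply/andP; split.
    rewrite -[(_ %| _)%N]/(W ^+ 3 %| D ^+ 3)%Z -(@Gauss_dvdzr _ (U ^+ 3));
      last first.
      by rewrite coprimez_sym coprimezXl // coprimezXr.
    have -> : U ^+ 3 * D ^+ 3 = W ^+ 3 * (m * D ^+ 3 - V ^+ 3).
      by move: hZ; rewrite mulrBr; lra.
    by rewrite dvdz_mulr.
  rewrite -[(_ %| _)%N]/(D ^+ 3 %| W ^+ 3)%Z -(@Gauss_dvdzr _ (V ^+ 3));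
    last first.
    by rewrite coprimez_sym coprimezXl // coprimezXr.
  have -> : V ^+ 3 * W ^+ 3 = D ^+ 3 * (m * W ^+ 3 - U ^+ 3).
    by move: hZ; rewrite mulrBr; lra.
  by rewrite dvdz_mulr.
have hUV : U ^+ 3 + V ^+ 3 = m * W ^+ 3.
  apply: (@mulIf _ (W ^+ 3)); first by rewrite expf_neq0 // gt_eqF.
  by rewrite mulrDl; move: hZ; rewrite -WD.
have cVW : coprimez V W by rewrite WD.
have denE : den p = W by rewrite /den pE.
exists U, V; rewrite denE; split=> //.
  by rewrite pE proj_of_int ?gt_eqF // uE vE WD.
split=> //; rewrite coprimezE /coprime eqn_leq gcdn_gt0 !absz_gt0.
have UV0 : (U != 0) || (V != 0).
  apply: contraNT hm; rewrite negb_or !negbK => /andP[/eqP U0 /eqP V0].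
  move/eqP: hUV; rewrite U0 V0 !expr0n addr0 eq_sym mulf_eq0 expf_eq0 /=.
  by rewrite (gt_eqF W0) orbF.
rewrite UV0 andbT leqNgt; apply/negP => /hcf; apply/negP; rewrite negbK.
set g := gcdn _ _.
have gW : coprimez (g%:Z ^+ 3) (W ^+ 3).
  rewrite coprimezXl // coprimezXr //; apply: coprimez_dvd cUW.
  exact: dvdn_gcdl.
have : (g%:Z ^+ 3 %| m)%Z.
  rewrite -(@Gauss_dvdzl _ _ (W ^+ 3)) // -hUV.
  have e a : (g%:Z %| a)%Z -> (g%:Z ^+ 3 %| a ^+ 3)%Z.
    by move=> /dvdzP[k ->]; rewrite exprMn dvdz_mull.
  by rewrite rpredD // e //; [exact: dvdn_gcdl | exact: dvdn_gcdr].
by rewrite dvdzE abszX.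
Qed.

(** [W] divides [Z] because it is prime to [U]. The quotient [l] is the factor that cancels in an
    integral addition formula. *)
Lemma primitive_scale p U V W X Y Z :
  primitive_coords p U V W -> coords p = proj (of_int X Y Z) -> Z != 0 ->
  exists l, [/\ X = l * U, Y = l * V & Z = l * W].
Proof.
move=> [W0 pE _ [_ UW _]]; have W0' : W != 0 by rewrite gt_eqF.
move=> + Z0; rewrite pE !proj_of_int // => -[e1 e2].
have cross a b : (a%:~R : rat) / W%:~R = b%:~R / Z%:~R -> a * Z = b * W.
  move=> e; apply: (@intr_inj rat); rewrite !rmorphM /=.
  have -> : (a%:~R : rat) = b%:~R / Z%:~R * W%:~R by rewrite -e divfK ?intr_eq0.
  by rewrite mulrAC divfK ?intr_eq0.
have /dvdzP[l lE] : (W %| Z)%Z.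
  rewrite -(@Gauss_dvdzr W U) 1?coprimez_sym // (cross _ _ e1).
  by rewrite dvdz_mull.
exists l; split=> //; apply: (mulIf W0').
  by rewrite -(cross _ _ e1) lE; ring.
by rewrite -(cross _ _ e2) lE; ring.
Qed.

End Points.

(** * Denominators of multiples and absence of torsion *)

Section Multiples.

Variables (m : int) (hm : m != 0) (hcf : cube_free m).

Implicit Types (p q : CQ hm) (U V W X Y Z : int).

Lemma of_int_eq0 U V W :
  (of_int U V W == (0, 0, 0)) = [&& U == 0, V == 0 & W == 0].
Proof. by rewrite !xpair_eqE !intr_eq0 -andbA. Qed.

Lemma coords_neq0 p X Y Z : coords p = proj (of_int X Y Z) -> Z != 0 -> p != 0.
Proof.
move=> + Z0; apply: contra_eqN => /eqP->.
by rewrite proj_of_int // !xpair_eqE andbF.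
Qed.

Lemma proj_third0 U V : (proj (of_int U V 0)).2 = 0.
Proof. by rewrite /proj /= mulr0. Qed.

Lemma tangentZ c (t : triple) (k : rat) :
  tangent k (scale c t) = scale (c ^+ 4) (tangent k t).
Proof. by case: t => -[u v] w /=; congr (_, _, _); ring. Qed.

Lemma coords_double p U V W : primitive_coords p U V W ->
  coords (p + p) = proj (of_int (- (V * (U ^+ 3 + m * W ^+ 3)))
    (U * (V ^+ 3 + m * W ^+ 3)) (W * (U ^+ 3 - V ^+ 3))).
Proof.
case=> W0 pE _ _; rewrite coordsD (addE (hmQ hm)) ?coordsP //; cbv beta;
  rewrite eqxx pE.
have [|c c0 ->] := @proj_scale (of_int U V W).
  by rewrite of_int_eq0 (gt_eqF W0) !andbF.
rewrite tangentZ swapZ projZ ?expf_neq0 //; congr proj.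
by rewrite /of_int /= !(rmorphN, rmorphD, rmorphM, rmorphXn, rmorphB).
Qed.

(** A common divisor of [m] and [U] divides [V ^+ 3], and symmetrically. *)
Lemma coprimez_m p U V W : primitive_coords p U V W -> coprimez m (U * V).
Proof.
case=> _ _ h [UV _ _].
have c a b : coprimez a b -> a ^+ 3 + b ^+ 3 = m * W ^+ 3 -> coprimez m a.
  move=> ab hab; apply: coprimez_of_dvd => d dm da.
  apply: (@dvdz_coprimez d (b ^+ 3)); last first.
    by rewrite coprimezXr //; apply: coprimez_dvd ab.
  have -> : b ^+ 3 = m * W ^+ 3 - a * a ^+ 2 by rewrite -hab; ring.
  by rewrite rpredB // dvdz_mulr.
rewrite coprimezMr (c _ _ UV) // (c V U) //; first by rewrite coprimez_sym.
by rewrite addrC.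
Qed.

Hypothesis m2 : (2 < `|m|)%N.

(** The duplication formula has third coordinate [W * (U ^+ 3 - V ^+ 3)]. The factor cancelled from
    it divides 3, while the difference of cubes exceeds 3 in absolute value. *)
Lemma double_den p : p != 0 -> p + p != 0 /\ den p < den (p + p).
Proof.
move=> p0; have [U [V hp]] := primitive_exists hcf p0.
set W := den p in hp *; have cE := coords_double hp.
have [W0 pE h [UV UW VW]] := hp; have W0' : W != 0 by rewrite gt_eqF.
have W3 : (1 <= `|W| ^ 3)%N by rewrite expn_gt0 absz_gt0 W0'.
have abs_h : (`|(U ^+ 3 + V ^+ 3)%R| = `|m| * `|W| ^ 3)%N
  by rewrite h abszM abszX.
(* By coprimality, [U = 0], [V = 0] or [U = V] would make [m * W ^+ 3] equal to 1 or 2 up to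
   sign. *)
have U0 : U != 0.
  apply: contraTneq m2 => U0; move: UV abs_h.
  by rewrite U0 /coprimez gcd0z expr0n add0r abszX eqz_nat => /eqP->; nia.
have V0 : V != 0.
  apply: contraTneq m2 => V0; move: UV abs_h.
  by rewrite V0 /coprimez gcdz0 expr0n addr0 abszX eqz_nat => /eqP->; nia.
have UVn : U != V.
  apply: contraTneq m2 => UE; move: UV abs_h.
  rewrite UE coprimezE /coprime gcdnn => /eqP e.
  rewrite -mulr2n -mulr_natl abszM abszX e; nia.
have UVn' : U != - V.
  apply: contra_eqN h => /eqP->.
  by rewrite exprNn mulN1r addNr eq_sym mulf_neq0 // expf_neq0.
have D3 := diff_cubes_gt3 U0 V0 UVn UVn'.
have Z0 : W * (U ^+ 3 - V ^+ 3) != 0.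
  by rewrite mulf_neq0 // -absz_gt0; apply: leq_trans D3.
have pp0 := coords_neq0 cE Z0; split=> //.
have [U' [V' hpp]] := primitive_exists hcf pp0.
have [l [lU lV lW]] := primitive_scale hpp cE Z0.
have W'0 : 0 < den (p + p) by case: hpp.
(* [l] is prime to [U] and [V], so it divides [2 * U ^+ 3 + V ^+ 3] and [U ^+ 3 + 2 * V ^+ 3], hence
   [3 * U ^+ 3]. *)
have : (l %| 3)%Z.
  have dX : (l %| V * (U ^+ 3 + m * W ^+ 3))%Z.
    by have : (l %| l * U')%Z by [exact: dvdz_mulr]; rewrite -lU !dvdzE abszN.
  have dY : (l %| U * (V ^+ 3 + m * W ^+ 3))%Z by rewrite lV dvdz_mulr.
  rewrite -h in dX dY.
  have lV1 : coprimez l V.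
    apply: coprimez_of_dvd => d dl dV; apply: (@dvdz_coprimez d (U ^+ 4)).
      have -> : U ^+ 4 = U * (V ^+ 3 + (U ^+ 3 + V ^+ 3)) - V * (2 * U * V ^+
        2).
        by ring.
      by apply: rpredB; [exact: dvdz_trans dl dY | exact: dvdz_mulr].
    by rewrite coprimezXr //; apply: coprimez_dvd dV _; rewrite coprimez_sym.
  have lU1 : coprimez l U.
    apply: coprimez_of_dvd => d dl dU; apply: (@dvdz_coprimez d (V ^+ 4)).
      have -> : V ^+ 4 = V * (U ^+ 3 + (U ^+ 3 + V ^+ 3)) - U * (2 * V * U ^+
        2).
        by ring.
      by apply: rpredB; [exact: dvdz_trans dl dX | exact: dvdz_mulr].
    by rewrite coprimezXr //; apply: coprimez_dvd UV.
  rewrite -(@Gauss_dvdzl l 3 (U ^+ 3)) ?coprimezXr //.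
  rewrite Gauss_dvdzr // in dX; rewrite Gauss_dvdzr // in dY.
  have -> : 3 * U ^+ 3 = 2 * (U ^+ 3 + (U ^+ 3 + V ^+ 3))
    - (V ^+ 3 + (U ^+ 3 + V ^+ 3)) by ring.
  by rewrite rpredB // dvdz_mull.
rewrite dvdzE => /dvdn_leq l3.
have := congr1 absz lW; rewrite !abszM => lWa.
rewrite -(gtz0_abs W0) -(gtz0_abs W'0) ltz_nat.
move: l3 lWa D3; rewrite -absz_gt0 in W0'; move: W0'.
move: `|W|%N `|l|%N `|den (p + p)%R|%N `|(U ^+ 3 - V ^+ 3)%R|%N => w l' w' d.
by clear; move=> w0 l3 e d3; nia.
Qed.

(** Modulo [d], the third coordinate of [law1] vanishes and the first is the unit
    [U2 ^+ 2 * U1 * V1]. The cancelled factor is thus prime to [d]. *)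
Lemma den_dvd_add p q (d : int) : p != 0 -> q != 0 -> p + q != 0 ->
  (d %| den p)%Z -> (d %| den q)%Z -> (d %| den (p + q))%Z.
Proof.
move=> p0 q0 pq0 dp dq.
have [U1 [V1 hp]] := primitive_exists hcf p0.
have [U2 [V2 hq]] := primitive_exists hcf q0.
have [U [V hpq]] := primitive_exists hcf pq0.
set W1 := den p in hp dp; set W2 := den q in hq dq; set W := den _ in hpq *.
have [d1|d1] := eqVneq (`|d|%N) 1%N; first by rewrite dvdzE d1 dvd1n.
pose X := U2 ^+ 2 * U1 * V1 + m * W1 ^+ 2 * W2 * V2.
pose Y := - (m * W2 ^+ 2 * W1 * U1) - V1 ^+ 2 * U2 * V2.
pose Z := V2 ^+ 2 * W1 * V1 - U1 ^+ 2 * W2 * U2.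
have [_ pE _ [_ UW1 VW1]] := hp; have [_ qE _ [_ UW2 VW2]] := hq.
have dX : coprimez d X.
  have [k kE] := dvdzP dp.
  have -> : X = U2 ^+ 2 * U1 * V1 + (m * W1 * W2 * V2 * k) * d.
    by rewrite -[_ * k * d]mulrA -kE /X; ring.
  have dU2 : coprimez d U2 by apply: coprimez_dvd dq _; rewrite coprimez_sym.
  have dU1 : coprimez d U1 by apply: coprimez_dvd dp _; rewrite coprimez_sym.
  have dV1 : coprimez d V1 by apply: coprimez_dvd dp _; rewrite coprimez_sym.
  by apply: coprimez_addM; rewrite !coprimezMr dU1 dV1 ?coprimezXr ?dU2.
have X0 : X != 0.
  apply: contraNneq d1 => X0; move: dX; rewrite X0 /coprimez gcdz0.
  by rewrite eqz_nat.
have cE : coords (p + q) = proj (of_int X Y Z).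
  have lawE : law m%:~R true (of_int U1 V1 W1) (of_int U2 V2 W2) = of_int X Y Z.
    by rewrite /of_int /= !(rmorphN, rmorphD, rmorphM, rmorphXn, rmorphB).
  have [|c c0 cE] := @proj_scale (of_int U1 V1 W1).
    by case: hp => W0 *; rewrite of_int_eq0 (gt_eqF W0) !andbF.
  have [|c' c'0 c'E] := @proj_scale (of_int U2 V2 W2).
    by case: hq => W0 *; rewrite of_int_eq0 (gt_eqF W0) !andbF.
  have lE : law m%:~R true (coords p) (coords q)
      = scale (c ^+ 2 * c' ^+ 2) (of_int X Y Z).
    by rewrite pE qE cE c'E lawZl lawZr scale_scale lawE.
  rewrite coordsD (law_add (hmQ hm) (b := true)) ?coordsP // lE.
    by rewrite projZ // mulf_neq0 ?expf_neq0.
  by rewrite scale_eq0 ?mulf_neq0 ?expf_neq0 // of_int_eq0 (negPf X0).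
have Z0 : Z != 0.
  have [W0 pqE _ _] := hpq.
  have W0' : W != 0 by rewrite gt_eqF.
  have w1 : (coords (p + q)).2 = 1 by rewrite pqE proj_of_int.
  by apply: contra_eqN w1 => /eqP Z0; rewrite cE Z0 proj_third0 eq_sym oner_eq0.
have [l [lX lY lZ]] := primitive_scale hpq cE Z0.
have dl : coprimez d l by move: dX; rewrite lX coprimezMr => /andP[].
rewrite -(@Gauss_dvdzr d l) // -lZ /Z.
rewrite rpredB //.
  by rewrite mulrAC dvdz_mull.
by rewrite mulrAC dvdz_mull.
Qed.

Lemma den_dvd_mulrn p n : p *+ n != 0 -> (den p %| den (p *+ n))%Z.
Proof.
case: n => [|n]; first by rewrite mulr0n eqxx.
elim: n => [|n IH]; first by rewrite dvdzz.
rewrite mulrS => h; have [n0|n0] := eqVneq (p *+ n.+1) 0.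
  by rewrite n0 addr0 dvdzz.
have p0 : p != 0 by apply: contraNneq n0 => ->; rewrite mul0rn.
by apply: den_dvd_add => //; apply: IH.
Qed.

Lemma mulrn_exp2_den p n : p != 0 ->
  p *+ (2 ^ n) != 0 /\ ((0 < n)%N -> den p < den (p *+ (2 ^ n))).
Proof.
move=> p0; elim: n => [|n [n0 IH]]; first by rewrite mulr1n.
have [nn0 lt_d] := double_den n0.
rewrite expnSr mulrnA mulr2n; split=> // _.
by case: (posnP n) IH => [n1 _|_ /(_ isT)/lt_trans]; [move: lt_d;
  rewrite n1 mulr1n | exact].
Qed.

(** For odd [n], [2 ^ totient n] is 1 modulo [n], so this multiple of [p] is [p] itself, although
    its denominator has grown. For even [n], [p *+ 2] vanishes by induction, against
    [double_den]. *)
Lemma torsion_free p n : (0 < n)%N -> p *+ n = 0 -> p = 0.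
Proof.
elim/ltn_ind: n p => n IH p n0 pn; apply/eqP; apply: contraT => p0.
have [on|en] := boolP (odd n).
  have n2 : coprime 2 n by rewrite prime_coprime // dvdn2 on.
  have [_ /(_ _)] := mulrn_exp2_den (totient n) p0.
  rewrite totient_gt0 => /(_ n0).
  have e := Euler_exp_totient n2.
  have -> : p *+ (2 ^ totient n) = p *+ ((2 ^ totient n) %% n).
    by rewrite {1}(divn_eq (2 ^ totient n) n) mulrnDr mulnC mulrnA pn mul0rn
      add0r.
  rewrite e.
  (* The case [n = 1] is apart, since 1 reduces to 0 modulo 1. *)
  case: (ltngtP n 1%N) n0 => // [n1 _|n1 _];
    first by rewrite modn_small // mulr1n ltxx.
  by move: pn p0; rewrite n1 mulr1n => ->; rewrite eqxx.
have nE : n = (2 * n./2)%N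
  by rewrite mul2n -[LHS](odd_double_half n) (negPf en).
have h2 : (0 < n./2)%N by move: n0; rewrite {1}nE muln_gt0.
have /IH : (n./2 < n)%N
  by rewrite {2}nE mul2n -addnn -[X in (X < _)%N]addn0 ltn_add2l.
move=> /(_ (p *+ 2) h2); rewrite -mulrnA -nE => /(_ pn) p2.
by have [] := double_den p0; rewrite -mulr2n p2 eqxx.
Qed.

End Multiples.

(** * The function x = UV / W^2 at S + T and T - S *)

Section SumDiff.

Variables (m : int) (hm : m != 0).
Implicit Types (S T : CQ hm).

Lemma coords_add_neq S T (u1 v1 u2 v2 a b : rat) : S != T ->
  coords S = (u1, v1, 1) -> coords T = (u2, v2, 1) -> coords (S + T) = (a, b,
    1) ->
  let B := u2 ^+ 2 * u1 + v2 ^+ 2 * v1 - m%:~R in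
  let A := u1 ^+ 2 * u2 + v1 ^+ 2 * v2 - m%:~R in
  [/\ B - A != 0, a * (B - A) = B * v1 - A * v2 & b * (B - A) = B * u1 - A *
    u2].
Proof.
move=> ST SE TE + B A; rewrite coordsD (addE (hmQ hm)) ?coordsP //; cbv beta.
have /negPf-> : coords S != coords T by apply: contraNneq ST => /coords_inj->.
rewrite SE TE; set c := swap _.
have cE : c = (B * v1 - A * v2, B * u1 - A * u2, B - A).
  by rewrite /c /chord /= /B /A; congr (_, _, _); ring.
rewrite {}cE; have [->|BA] := eqVneq (B - A) 0.
  move=> /(congr1 (fun t : triple => t.2)) /=.
  by rewrite mulr0 => /esym/eqP; rewrite oner_eq0.
by rewrite /proj /= BA => -[<- <-]; rewrite ![_^-1 * _]mulrC !divfK.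
Qed.

(* x = UV / W^2 is invariant under translation by the three flexes with W = 0;
   with y = (U^3 - V^3) / W^3 it satisfies y^2 = m^2 - 4 x^3, and these are the
   usual formulas for x(S + T) and x(S - T) on that isogenous curve. *)
Lemma sum_diff_xcoord S T (u1 v1 u2 v2 a b a' b' : rat) :
  coords S = (u1, v1, 1) -> coords T = (u2, v2, 1) ->
  coords (S + T) = (a, b, 1) -> coords (T - S) = (a', b', 1) ->
  let x1 := u1 * v1 in let x2 := u2 * v2 in
  [/\ x1 != x2, (a * b + a' * b') * (x1 - x2) ^+ 2
        = 2 * x1 * x2 * (x1 + x2) - m%:~R ^+ 2
    & (a * b) * (a' * b') * (x1 - x2) ^+ 2
        = x1 ^+ 2 * x2 ^+ 2 + m%:~R ^+ 2 * (x1 + x2)].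
Proof.
move=> SE TE PE RE x1 x2.
have affine (p : CQ hm) (u v : rat) : coords p = (u, v,
  1) -> u ^+ 3 = m%:~R - v ^+ 3.
  move=> pE; have /andP[_ /eqP] := coordsP p; rewrite pE /= expr1n mulr1.
  by move=> /eqP; rewrite subr_eq0 => /eqP <-; rewrite addrK.
have h1 := affine _ _ _ SE; have h2 := affine _ _ _ TE.
have nz (p : CQ hm) (u v : rat) : coords p = (u, v, 1) -> p != 0.
  by move=> pE; apply: contra_eqN pE => /eqP ->; rewrite xpair_eqE andbF.
have ST : S != T by apply: contraTneq (nz _ _ _ RE) => ->; rewrite subrr eqxx.
have NST : - S != T.
  by apply: contraTneq (nz _ _ _ PE) => <-; rewrite subrr eqxx.
have NSE : coords (- S) = (v1, u1, 1).
  have -> : coords (- S) = proj (swap (coords S)) by [].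
  by rewrite SE proj_id //= oner_eq0.
rewrite [T - S]addrC in RE.
have [d0 aE bE] := coords_add_neq ST SE TE PE.
have [d0' a'E b'E] := coords_add_neq NST NSE TE RE.
move: d0 aE bE d0' a'E b'E; set d := (_ - _); set d' := (_ - _ - (_ - m%:~R)).
move=> d0 aE bE d0' a'E b'E.
(* On the curve, the denominators [d] and [d'] of the two chords have product [(x1 - x2) * k]; the
   extra factor [k ^+ 2] is cancelled at the end. *)
pose k : rat := m%:~R * (u2 + v2 - u1 - v1) + x1 * (u2 + v2) ^+ 2 - x2 * (u1 +
  v1) ^+ 2.
have dd : d * d' = (x1 - x2) * k by rewrite /d /d' /k /x1 /x2; ring: h1 h2.
have x12 : x1 - x2 != 0.
  by apply: contraTneq (mulf_neq0 d0 d0') => x0; rewrite dd x0 mul0r eqxx.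
have k0 : k ^+ 2 != 0.
  rewrite expf_neq0 //; apply: contraTneq (mulf_neq0 d0 d0') => k0.
  by rewrite dd k0 mulr0 eqxx.
split; first by rewrite -subr_eq0.
  apply: (mulIf k0).
  transitivity ((a * b + a' * b') * (d * d') ^+ 2); first by rewrite dd; ring.
  transitivity ((a * d) * (b * d) * d' ^+ 2 + (a' * d') * (b' * d') * d ^+ 2).
    by ring.
  by rewrite aE bE a'E b'E /d /d' /k /x1 /x2; ring: h1 h2.
apply: (mulIf k0).
transitivity (a * b * (a' * b') * (d * d') ^+ 2); first by rewrite dd; ring.
transitivity ((a * d) * (b * d) * ((a' * d') * (b' * d'))); first by ring.
by rewrite aE bE a'E b'E /k /x1 /x2; ring: h1 h2.
Qed.
End SumDiff.

(** * Sums of two integral cubes *)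

Lemma cube_mod9 (u : int) :
  exists k, [\/ u ^+ 3 = 9 * k, u ^+ 3 = 9 * k + 1 | u ^+ 3 = 9 * k - 1].
Proof.
have [a [->|[->|->]]] : exists a : int,
  u = 3 * a \/ u = 3 * a + 1 \/ u = 3 * a - 1.
  by exists ((u + 1) %/ 3)%Z; lia.
- by exists (3 * a ^+ 3); constructor 1; ring.
- by exists (3 * a ^+ 3 + 3 * a ^+ 2 + a); constructor 2; ring.
- by exists (3 * a ^+ 3 - 3 * a ^+ 2 + a); constructor 3; ring.
Qed.

(** Modulo 9 a sum of two cubes is 0, 1, -1, 2 or -2. *)
Lemma sum_cubes_ge7 (u v m : int) :
  u ^+ 3 + v ^+ 3 = m -> (2 < `|m|)%N -> (7 <= `|m|)%N.
Proof.
by have [a [|->|->]] := cube_mod9 u; have [b [|->|->]] := cube_mod9 v;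
  try move=> ->; try move=> ->; move=> <-; lia.
Qed.

(** [u + v] is a nonzero factor of [m], and its cofactor dominates [u * v]. *)
Lemma norm_mul_le_sum_cubes (u v m : int) :
  m != 0 -> u ^+ 3 + v ^+ 3 = m -> `|u * v| <= `|m|.
Proof.
move=> m0 h; have hm : m = (u + v) * (u ^+ 2 - u * v + v ^+ 2) by rewrite -h;
  ring.
have uv0 : u + v != 0 by apply: contraNneq m0 => e; rewrite hm e mul0r.
have a1 : 1 <= `|u + v| by rewrite -gtz0_ge1 normr_gt0.
have n1 : `|u * v| <= u ^+ 2 - u * v + v ^+ 2.
  have := sqr_ge0 (u + v); have := sqr_ge0 (u - v); rewrite sqrrB sqrrD.
  by move=> p1 p2; rewrite ler_norml; apply/andP; split; lra.
have n0 : 0 <= u ^+ 2 - u * v + v ^+ 2 by apply: le_trans n1.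
by apply: le_trans n1 _;
  rewrite hm [`|(u + v) * _|]normrM (ger0_norm n0) ler_peMl.
Qed.

(** * Integral points among the multiples of a point *)

Section Main.

Variables (m : int) (hm : m != 0) (hcf : cube_free m) (m2 : (2 < `|m|)%N).

Implicit Types (p q S T : CQ hm).

Lemma den_gt0 p : 0 < den p. Proof. exact: denq_gt0. Qed.

Lemma integral_coords p : p != 0 -> den p = 1 ->
  exists2 uv : int * int, uv.1 ^+ 3 + uv.2 ^+ 3 = m
                         & coords p = (uv.1%:~R, uv.2%:~R, 1).
Proof.
move=> p0 d1; have [u [v []]] := primitive_exists hcf p0.
rewrite d1 expr1n mulr1 => _ pE h _; exists (u, v) => //.
by rewrite pE proj_of_int // !divr1.
Qed.

(** Clearing denominators in [sum_diff_xcoord] gives the relations of [sum_diff_gcd_bound]. If [S]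
    or [T] were not integral, [O1 * O2] would be at least 4, and [sum_diff_size_contradiction] would
    apply. *)
Lemma integral_sum_diff S T : S != 0 -> T != 0 -> S + T != 0 -> T - S != 0 ->
  den (S + T) = 1 -> den (T - S) = 1 -> den S * den T = 1.
Proof.
move=> S0 T0 P0 R0 dP dR; apply/eqP; apply: contraT => dST.
have [[u v] /= h PE] := integral_coords P0 dP.
have [[u' v'] /= h' RE] := integral_coords R0 dR.
have [U1 [V1 hS]] := primitive_exists hcf S0.
have [U2 [V2 hT]] := primitive_exists hcf T0.
have [W1p SE _ [_ UW1 VW1]] := hS; have [W2p TE _ [_ UW2 VW2]] := hT.
set W1 := den S in hS W1p SE UW1 VW1 dST;
  set W2 := den T in hT W2p TE UW2 VW2 dST.
have W10 : W1 != 0 by rewrite gt_eqF.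
have W20 : W2 != 0 by rewrite gt_eqF.
rewrite proj_of_int // in SE; rewrite proj_of_int // in TE.
have [x12 hB hC] := sum_diff_xcoord SE TE PE RE.
pose X1 := U1 * V1; pose X2 := U2 * V2; pose O1 := W1 ^+ 2; pose O2 := W2 ^+ 2.
pose e := u * v + u' * v'; pose f := (u * v) * (u' * v').
pose D := (X1 * O2 - X2 * O1) ^+ 2.
have Q1 : (W1%:~R : rat) != 0 by rewrite intr_eq0.
have Q2 : (W2%:~R : rat) != 0 by rewrite intr_eq0.
have he : D * e = 2 * X1 * X2 * (X1 * O2 + X2 * O1) - m ^+ 2 * (O1 * O2) ^+ 2.
  apply: (@intr_inj rat).
  transitivity ((u%:~R * v%:~R + u'%:~R * v'%:~R) * (U1%:~R / W1%:~R * (V1%:~R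
    / W1%:~R) -
         U2%:~R / W2%:~R * (V2%:~R / W2%:~R)) ^+ 2 * (O1%:~R * O2%:~R) ^+ 2 :
           rat).
    rewrite /D /e /X1 /X2 /O1 /O2 !(rmorphM, rmorphD, rmorphB, rmorphXn) /=.
    by field; rewrite ?Q1 ?Q2.
  rewrite hB /X1 /X2 /O1 /O2 !(rmorphM, rmorphD, rmorphB, rmorphXn) /=.
  by field; rewrite ?Q1 ?Q2.
have hf : D * f = X1 ^+ 2 * X2 ^+ 2 + m ^+ 2 * (O1 * O2) * (X1 * O2 + X2 * O1).
  apply: (@intr_inj rat).
  transitivity ((u%:~R * v%:~R) * (u'%:~R * v'%:~R) * (U1%:~R / W1%:~R *
    (V1%:~R / W1%:~R) -
         U2%:~R / W2%:~R * (V2%:~R / W2%:~R)) ^+ 2 * (O1%:~R * O2%:~R) ^+ 2 :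
           rat).
    rewrite /D /f /X1 /X2 /O1 /O2 !(rmorphM, rmorphD, rmorphB, rmorphXn) /=.
    by field; rewrite ?Q1 ?Q2.
  rewrite hC /X1 /X2 /O1 /O2 !(rmorphM, rmorphD, rmorphB, rmorphXn) /=.
  by field; rewrite ?Q1 ?Q2.
have D0 : D != 0.
  rewrite /D expf_neq0 // subr_eq0; apply: contraNneq x12 => XO.
  have : (X1 * O2)%:~R = (X2 * O1)%:~R :> rat by rewrite XO.
  rewrite /X1 /X2 /O1 /O2 !(rmorphM, rmorphXn) /= => XO'.
  have WW : (W1%:~R ^+ 2 * W2%:~R ^+ 2 : rat) != 0.
    by apply: mulf_neq0; apply: expf_neq0.
  apply/eqP; apply: (mulIf WW).
  transitivity ((U1%:~R * V1%:~R * W2%:~R ^+ 2) : rat); first by field;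
    rewrite ?Q1 ?Q2.
  by rewrite XO'; field; rewrite ?Q1 ?Q2.
have D9 : D <= 9.
  apply: (sum_diff_gcd_bound _ _ (coprimez_m hS) D0 he hf).
    by rewrite /X1 /O1 coprimezMl !coprimezXr.
  by rewrite /X2 /O2 coprimezMl !coprimezXr.
have B1 := norm_mul_le_sum_cubes hm h; have B2 := norm_mul_le_sum_cubes hm h'.
have m7 : 7 <= `|m| by have := sum_cubes_ge7 h m2; rewrite -lez_nat abszE.
have N4 : 4 <= O1 * O2.
  rewrite /O1 /O2 -exprMn.
  have : 2 <= W1 * W2 by have := mulr_gt0 W1p W2p; move: dST; clear; lia.
  by clear; nia.
have mm : `|m| ^+ 2 = m ^+ 2 by rewrite real_normK // num_real.
exfalso; apply: (@sum_diff_size_contradiction `|m| (O1 * O2) D e f (X1 * O2 *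
  (X2 * O1)) (X1 * O2 + X2 * O1)) => //.
- exact: sqr_ge0.
- by rewrite (le_trans (ler_normD _ _)) //; move: B1 B2; clear; lra.
- by rewrite /f normrM expr2 ler_pM.
- by rewrite /D; ring.
- by rewrite mm he; ring.
- transitivity (D * f * (O1 * O2) ^+ 2 + D * e * (O1 * O2) * (X1 * O2 + X2 *
  O1)).
    by rewrite he hf /D; ring.
  by ring.
Qed.

Lemma integral_multiple p n : (0 < n)%N -> p *+ n != 0 -> den (p *+ n) = 1 ->
  n = 1%N.
Proof.
move=> n0 pn0 dn; have p0 : p != 0 by apply: contraNneq pn0 => ->;
  rewrite mul0rn.
have nz k : (0 < k)%N -> p *+ k != 0.
  by move=> k0; apply: contraNneq p0 => /(torsion_free hcf m2 k0)->.
have even_den k : (0 < k)%N -> 1 < den (p *+ k.*2).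
  move=> /nz kn; rewrite -addnn mulrnDr.
  by have [_] := double_den hcf m2 kn; apply: le_lt_trans;
    rewrite -gtz0_ge1 den_gt0.
have d1 : den p = 1.
  have := den_dvd_mulrn hcf pn0; rewrite dn dvdz1 => /eqP e.
  by rewrite -(gtz0_abs (den_gt0 p)) e.
have nE := odd_double_half n; case on: (odd n) nE => nE; last first.
  have h0 : (0 < n./2)%N by rewrite -double_gt0 -[_.*2]add0n nE.
  by have := even_den _ h0; rewrite -[_.*2]add0n nE dn.
case: (posnP n./2) => [k0|k0]; first by rewrite -nE k0.
set k := n./2 in k0 nE.
have E1 : p *+ k + p *+ k.+1 = p *+ n by rewrite -mulrnDr -nE -addnn addnS.
have E2 : p *+ k.+1 - p *+ k = p by rewrite mulrS addrK.
have := @integral_sum_diff (p *+ k) (p *+ k.+1).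
rewrite E1 E2 => /(_ (nz _ k0) (nz k.+1 isT) pn0 p0 dn d1) dd.
have g1 := den_gt0 (p *+ k); have g2 := den_gt0 (p *+ k.+1).
(* Whichever of [k], [k.+1] is even is positive, so that multiple has denominator above 1. *)
have [ok|ek] := boolP (odd k).
  have /even_den : (0 < k.+1./2)%N by clear -k0; lia.
  rewrite (_ : k.+1./2.*2 = k.+1)%N; last by clear -ok; lia.
  by move: dd g1 g2; clear; nia.
have /even_den : (0 < k./2)%N by clear -k0 ek; lia.
rewrite (_ : k./2.*2 = k)%N; last by clear -ek; lia.
by move: dd g1 g2; clear; nia.
Qed.

Lemma integral_multiplez p (n : int) :
  p *~ n != 0 -> den (p *~ n) = 1 -> n = 1 \/ n = -1.
Proof.
case: (intP n) => [|k|k]; first by rewrite mulr0z eqxx.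
  by rewrite -pmulrn => h1 h2; left; rewrite (integral_multiple _ h1 h2).
rewrite -nmulrn -mulNrn => h1 h2; right.
by rewrite (integral_multiple _ h1 h2).
Qed.

Lemma torsion_freez p (n : int) : p *~ n = 0 -> n != 0 -> p = 0.
Proof.
case: (intP n) => [//|k|k] + _;
  first by rewrite -pmulrn => /(torsion_free hcf m2 (ltn0Sn k)).
by rewrite -nmulrn => /eqP;
  rewrite oppr_eq0 => /eqP/(torsion_free hcf m2 (ltn0Sn k)).
Qed.

End Main.

(** * Torsion for |m| <= 2 *)

Section SmallTorsion.

Variables (m : int) (hm : m != 0) (hcf : cube_free m).

Implicit Types (p : CQ hm).

Lemma proj_of_intZ (l U V W : int) : l != 0 ->
  proj (of_int (l * U) (l * V) (l * W)) = proj (of_int U V W).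
Proof.
move=> l0; rewrite -(@projZ l%:~R (of_int U V W)) ?intr_eq0 //.
by rewrite /of_int /= !rmorphM.
Qed.

Lemma coords_opp_primitive p U V W : primitive_coords p U V W ->
  coords (- p) = proj (of_int V U W).
Proof. by case/primitive_opp. Qed.

(** When [m] is 1 or -1, [fermat3] leaves [U = 0] or [V = 0], points killed by 3; when [m] is 2 or
    -2, [U = V] and the point is its own opposite. *)
Lemma small_torsion p : (`|m| <= 2)%N -> p *+ 6 = 0.
Proof.
move=> m2; have [->|p0] := eqVneq p 0; first by rewrite mul0rn.
have [U [V hp]] := primitive_exists hcf p0; have [W0 pE h [UV UW VW]] := hp.
set W := den p in hp W0 pE h UW VW; have W0' : W != 0 by rewrite gt_eqF.
have W3 : W ^+ 3 != 0 by rewrite expf_neq0.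
(* The sign of [m] is moved into [z], which is [W] or [- W]. *)
have [e [e_or [z zW mE]]] : exists e : int, (e = 1 \/ e = 2) /\
    exists2 z : int, `|z|%N = `|W|%N & m * W ^+ 3 = e * z ^+ 3.
  have [m0|m0] := lerP 0 m.
    by exists m; split; [move: m0 m2 hm; clear; lia | exists W].
  exists (- m); split; first by move: m0 m2; clear; lia.
  by exists (- W); rewrite ?abszN // exprNn; ring.
have z0 : z != 0 by rewrite -absz_gt0 zW absz_gt0.
have Uz : coprimez U z by move: UW; rewrite !coprimezE zW.
have Vz : coprimez V z by move: VW; rewrite !coprimezE zW.
rewrite mE in h; move: e_or mE h => -[->|->] mE h; last first.
  have UVE := sum_cubes_eq_double_cube UV z0 h.
  have pN : - p = p.
    by apply: coords_inj; rewrite (coords_opp_primitive hp) pE UVE.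
  by rewrite (mulrnA p 2 3) mulr2n -{1}pN addNr mul0rn.
rewrite mul1r in h mE.
have z30 : z ^+ 3 != 0 by rewrite expf_neq0.
suff pN : p + p = - p.
  have p3 : p *+ 3 = 0 by rewrite mulrSr mulr2n pN addNr.
  by rewrite (mulrnA p 3 2) p3 mul0rn.
apply: coords_inj; rewrite (coords_double hp) (coords_opp_primitive hp) -/W mE
  -h.
(* The duplication formula becomes [- V ^+ 3] or [U ^+ 3] times the coordinates [(V, U, W)] of
   [- p]. *)
have [U0|V0] := fermat3 UV Uz Vz z0 h.
  have V0 : - V ^+ 3 != 0.
    by rewrite oppr_eq0; apply: contra_neq z30 => V0; rewrite -h U0 V0.
  rewrite -(proj_of_intZ V U W V0) U0; congr (proj (of_int _ _ _)); ring.
have U0 : U ^+ 3 != 0.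
  by apply: contra_neq z30 => U0; rewrite -h U0 V0.
rewrite -(proj_of_intZ V U W U0) V0; congr (proj (of_int _ _ _)); ring.
Qed.

End SmallTorsion.

(** * Generators in rank one *)

Lemma has_rank1_relation (A : zmodType) (x y : A) : has_rank A 1 ->
  exists a b : int, (a != 0) || (b != 0) /\ x *~ a + y *~ b = 0.
Proof.
move=> [_ /(_ 2%N (fun i : 'I_2 => if i == ord0 then x else y)) h].
apply: NNPP => none; suff /h : independent (fun i : 'I_2 =>
  if i == ord0 then x else y) by [].
move=> k; rewrite big_ord_recl big_ord1 /= => sum0.
have [/norP[]|nz] := boolP (~~ ((k ord0 != 0) || (k (lift ord0 ord0) != 0))).
  rewrite !negbK => /eqP k0 /eqP k1 i.
  by case: (unliftP ord0 i) => [j ->|->] //; rewrite (ord1 j).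
by case: none; exists (k ord0), (k (lift ord0 ord0)); rewrite negbK in nz.
Qed.

Lemma den_integral_point (m : int) (hm : m != 0) (u v : int) (h : u ^+ 3 + v ^+
  3 = m) :
  den (integral_point hm h) = 1.
Proof. exact: denq_int. Qed.

Lemma integral_point_neq0 (m : int) (hm : m != 0) (u v : int) (h : u ^+ 3 + v
  ^+ 3 = m) :
  integral_point hm h != 0.
Proof. by apply: contraTneq isT => /(congr1 (@coords m hm)). Qed.

(** Without torsion, a relation between [p] and [q] may be divided by the gcd of its coefficients.
    Bezout then gives [r] with [p = r *~ b'] and [q = - (r *~ a')], and integrality of [p] forces
    [b'] to be 1 or -1. *)
Lemma integral_point_generates (m : int) (hm : m != 0) (u v : int)
    (h : u ^+ 3 + v ^+ 3 = m) :
  cube_free m -> (2 < `|m|)%N -> has_rank (CQ hm) 1 ->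
  generates (integral_point hm h).
Proof.
move=> hcf m2 hr q; set p := integral_point hm h.
have [a [b [ab0 rel]]] := has_rank1_relation p q hr.
have g0 : gcdz a b != 0 by rewrite gcdz_eq0 negb_and.
have /dvdzP[a' aE] := dvdz_gcdl a b; have /dvdzP[b' bE] := dvdz_gcdr a b.
have rel' : p *~ a' + q *~ b' = 0.
  apply: (torsion_freez hcf m2 _ g0).
  by rewrite mulrzDl -!mulrzA -aE -bE.
have [x [y xy]] := Bezoutz a b.
have xy' : x * a' + y * b' = 1.
  by apply: (mulIf g0); rewrite mulrDl -!mulrA -aE -bE xy mul1r.
pose r := p *~ y - q *~ x.
have pE : p = r *~ b'.
  rewrite mulrzBl -!mulrzA [x * b']mulrC [q *~ _]mulrzA.
  have -> : q *~ b' = - (p *~ a') by apply/eqP; rewrite -addr_eq0 addrC rel'.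
  by rewrite mulNrz opprK -mulrzA -mulrzDr [a' * x]mulrC addrC xy' mulr1z.
have qE : q = - (r *~ a').
  rewrite mulrzBl -!mulrzA [y * a']mulrC [p *~ _]mulrzA.
  have -> : p *~ a' = - (q *~ b') by apply/eqP; rewrite -addr_eq0 rel'.
  by rewrite mulNrz opprB opprK -mulrzA -mulrzDr [b' * y]mulrC xy' mulr1z.
have [||b1|b1] := integral_multiplez hcf m2 (p := r) (n := b').
- by rewrite -pE integral_point_neq0.
- by rewrite -pE den_integral_point.
- by exists (- a'); rewrite pE b1 mulr1z qE mulrNz.
by exists a'; rewrite pE b1 mulrN1z qE mulNrz.
Qed.

Theorem corollary1p3 (m : int) (hm : m != 0) (hcf : cube_free m)
    (hrank : has_rank (CQ hm) 1) :
  (forall s : seq (int * int), uniq s ->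
     (forall p : int * int, p \in s -> p.1 ^+ 3 + p.2 ^+ 3 = m) ->
     (size s <= 2)%N)
  /\ (forall (u v : int) (h : u ^+ 3 + v ^+ 3 = m),
        generates (integral_point hm h)).
Proof.
(* For small [m] every point is killed by 6, so no single point is independent. *)
have [m2|m2] := leqP `|m|%N 2.
  have [[x ind] _] := hrank.
  by have /(_ _ ord0) := ind (fun=> 6);
    rewrite big_ord1 -pmulrn small_torsion // => /(_ erefl).
split=> [s us hs|u v h]; last exact: integral_point_generates.
case: s us hs => [//|[u v] s] us hs.
have h : u ^+ 3 + v ^+ 3 = m by apply: (hs (u, v)); rewrite mem_head.
suff sub : {subset (u, v) :: s <= [:: (u, v);
  (v, u)]} by apply: (uniq_leq_size us sub).
move=> [u' v'] /hs /= h'.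
(* The first solution is [n] times any other one; being integral it has [n = 1] or [n = -1], and
   taking the opposite swaps the coordinates. *)
have [n nE] := integral_point_generates h' hcf m2 hrank (integral_point hm h).
have [||n1|n1] := integral_multiplez hcf m2 (p := integral_point hm h') (n :=
  n).
- by rewrite -nE integral_point_neq0.
- by rewrite -nE den_integral_point.
- move: nE; rewrite n1 mulr1z =>
  /(congr1 (@coords m hm)) [/intr_inj-> /intr_inj->].
  by rewrite mem_head.
move: nE; rewrite n1 mulrN1z => /(congr1 (@coords m hm)).
have -> : coords (- integral_point hm h') = proj (v'%:~R, u'%:~R, 1) by [].
rewrite proj_id /= ?oner_eq0 // => -[/intr_inj-> /intr_inj->].
by rewrite !inE eqxx orbT.
Qed.
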